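(* The operators $e_i,f_i,k_i,k_i^{-1}$ ($i\in I^+$) on $\mathcal X$ satisfy all defining relations of $U_q(\mathfrak{sp}_{2n})$ (listed in the context) with $E_i,F_i,K_i,K_i^{-1}$ replaced by $e_i,f_i,k_i,k_i^{-1}$. Consequently there is a unique surjective algebra homomorphism $\Psi:U_q(\mathfrak{sp}_{2n})\to U_q^{2n}$ with $E_i\mapsto e_i$, $F_i\mapsto f_i$, $K_i^{\pm1}\mapsto k_i^{\pm1}$, where $U_q^{2n}$ is the subalgebra of $\operatorname{End}_{\mathbf{k}}(\mathcal X)$ generated by $e_i,f_i,k_i,k_i^{-1}$ ($i\in I^+$).
   Context: Let $\mathbf{k}$ be a field of characteristic $0$, $q\in\mathbf{k}$ invertible and not a root of unity, $n\ge 2$, $I=\{-n,\dots,-1,1,\dots,n\}$, $I^+=\{1,\dots,n\}$, $\lambda=q-q^{-1}$, $[m]_q=\frac{q^m-q^{-m}}{q-q^{-1}}$, $[m]_q!=[1]_q\cdots[m]_q$, $\left[{m\atop k}\right]_q=\frac{[m]_q\cdots[m-k+1]_q}{[1]_q\cdots[k]_q}$ ($k>0$), $=1$ ($k=0$); $[A,B]=AB-BA$. The quantum symplectic space $\mathcal X$ is the $\mathbf{k}$-algebra generated by $x_i$ ($i\in I$) with relations $x_jx_i=qx_ix_j$ for $i<j$, $j\neq-i$, and $x_ix_{-i}=q^2x_{-i}x_i+q^2\lambda\Omega_{i+1}$ ($i\in I^+$), where $\Omega_i=\sum_{j=i}^nq^{j-i}x_{-j}x_j$ and $\Omega_{n+1}=0$.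 Normal monomials $x^a=x_{-n}^{a_{-n}}\cdots x_{-1}^{a_{-1}}x_1^{a_1}\cdots x_n^{a_n}$, $a\in\mathbb{N}_0^{I}$, form a basis; $\varepsilon_i$ is the $i$-th unit vector. Linear operators on $\mathcal X$: $\partial_i.x^a=[a_i]_qx^{a-\varepsilon_i}$ (zero if $a_i=0$), $x_{i_L}.f=x_if$, $x_{i_R}.f=fx_i$, $\mu_i^{\pm1}.x^a=q^{\pm a_i}x^a$; products are compositions. For $i\in I^+$, $\tau_i=\prod_{j=i}^n\mu_j$, $\tau_{-i}=\prod_{j=-n}^{-i}\mu_j$, $\tau_{n+1}=\tau_{-n-1}=1$. Define $e_1=[2]_q^{-1}q^{-1}\mu_1^{-1}(\tau_{-2}^{-1}x_{-1_L}+q^2\tau_2^{-1}x_{-1_R})\partial_1$, $f_1=[2]_q^{-1}q^{-1}\mu_{-1}^{-1}(\tau_2^{-1}x_{1_R}+q^2\tau_{-2}^{-1}x_{1_L})\partial_{-1}$, $k_1=\mu_{-1}^2\mu_1^{-2}$, and for $2\le i\le n$: $e_i=\mu_{i-1}\mu_i^{-1}\tau_{-i-1}^{-1}x_{-i_L}\partial_{1-i}-\tau_i^{-1}x_{i-1_R}\partial_i$, $f_i=-\mu_{1-i}\mu_{-i}^{-1}\tau_{i+1}^{-1}x_{i_R}\partial_{i-1}+\tau_{-i}^{-1}x_{1-i_L}\partial_{-i}$, $k_i=\mu_{-i}\mu_{1-i}^{-1}\mu_{i-1}\mu_i^{-1}$. $U_q(\mathfrak{sp}_{2n})$ is the algebra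 generated by $E_i,F_i,K_i,K_i^{-1}$ ($i\in I^+$) with relations $K_iK_j=K_jK_i$, $K_iK_i^{-1}=K_i^{-1}K_i=1$, $K_iE_jK_i^{-1}=q_i^{a_{ij}}E_j$, $K_iF_jK_i^{-1}=q_i^{-a_{ij}}F_j$, $[E_i,F_j]=\delta_{ij}\frac{K_i-K_i^{-1}}{q_i-q_i^{-1}}$, and for $i\neq j$: $\sum_{t=0}^{1-a_{ij}}(-1)^t\left[{1-a_{ij}\atop t}\right]_{q_i}E_i^tE_jE_i^{1-a_{ij}-t}=0$ and the same with $F$ in place of $E$. Here $q_1=q^2$, $q_i=q$ for $i>1$, and the Cartan matrix is $a_{ii}=2$, $a_{12}=-1$, $a_{21}=-2$, $a_{i,i+1}=a_{i+1,i}=-1$ for $2\le i\le n-1$, and $a_{ij}=0$ if $|i-j|>1$ (simple roots $\alpha_1=2\epsilon_1$, $\alpha_i=\epsilon_i-\epsilon_{i-1}$ for $i\ge2$). *)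

(* Defs.v *)
From HB Require Import structures.
From mathcomp Require Import all_boot all_order all_algebra.
Set Implicit Arguments.
Unset Strict Implicit.
Unset Printing Implicit Defensive.
Import Order.TTheory GRing.Theory Num.Theory.
Local Open Scope ring_scope.

Definition inI (n : nat) (i : int) : bool := (i != 0) && (absz i <= n)%N.

Definition Iseq (n : nat) : seq int :=
  [seq - (k%:Z) | k <- rev (iota 1 n)] ++ [seq k%:Z | k <- iota 1 n].

Definition qint (F : fieldType) (v : F) (m : nat) : F :=
  (v ^+ m - v ^- m) / (v - v^-1).

Definition qbinom (F : fieldType) (v : F) (m k : nat) : F :=
  (\prod_(l < k) qint v (m - l)) / (\prod_(l < k) qint v l.+1).

(* Cartan matrix of sp_{2n} (indices 1..n), alpha_1 = 2 eps_1 long. *)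
Definition cartan (i j : nat) : int :=
  if i == j then 2
  else if (i == 1%N) && (j == 2%N) then -1
  else if (i == 2%N) && (j == 1%N) then -2
  else if (i.+1 == j) || (j.+1 == i) then -1
  else 0.

Definition serre_deg (i j : nat) : nat := absz (1 - cartan i j).

Definition qi (F : fieldType) (q : F) (i : nat) : F :=
  if i == 1%N then q ^+ 2 else q.

Definition decr (a : int -> nat) (i : int) : int -> nat :=
  fun j => if j == i then (a j).-1 else a j.

Section QSymp.
Variables (F : fieldType) (X : algType F) (q : F) (n : nat) (x : int -> X).

Definition Omega (i : nat) : X :=
  \sum_(i <= j < n.+1) q ^+ (j - i) *: (x (- (j%:Z)) * x (j%:Z)).

Definition mono (a : int -> nat) : X := \prod_(i <- Iseq n) x i ^+ a i.

Definition opD (f g : X -> X) : X -> X := fun v => f v + g v.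
Definition opN (f : X -> X) : X -> X := fun v => - f v.
Definition opZ (c : F) (f : X -> X) : X -> X := fun v => c *: f v.
Definition op0 : X -> X := fun _ => 0.
Definition comps (l : seq (X -> X)) : X -> X := foldr (fun f g => f \o g) id l.

Definition xL (i : int) : X -> X := fun v => x i * v.
Definition xR (i : int) : X -> X := fun v => v * x i.

Variables (D M Mi : int -> X -> X). (* partial_i, mu_i, mu_i^{-1} *)

Definition tauPinv (i : nat) : X -> X :=
  comps [seq Mi (j%:Z) | j <- iota i (n.+1 - i)].
Definition tauNinv (i : nat) : X -> X :=
  comps [seq Mi (- (j%:Z)) | j <- iota i (n.+1 - i)].

Definition e_op (i : nat) : X -> X :=
  if i == 1%N then
    opZ ((qint q 2)^-1 * q^-1)
      (Mi 1 \o opD (tauNinv 2 \o xL (-1)) (opZ (q ^+ 2) (tauPinv 2 \o xR (-1))) \o D 1)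
  else
    opD (M (i%:Z - 1) \o Mi (i%:Z) \o tauNinv i.+1 \o xL (- (i%:Z)) \o D (1 - i%:Z))
        (opN (tauPinv i \o xR (i%:Z - 1) \o D (i%:Z))).

Definition f_op (i : nat) : X -> X :=
  if i == 1%N then
    opZ ((qint q 2)^-1 * q^-1)
      (Mi (-1) \o opD (tauPinv 2 \o xR 1) (opZ (q ^+ 2) (tauNinv 2 \o xL 1)) \o D (-1))
  else
    opD (opN (M (1 - i%:Z) \o Mi (- (i%:Z)) \o tauPinv i.+1 \o xR (i%:Z) \o D (i%:Z - 1)))
        (tauNinv i \o xL (1 - i%:Z) \o D (- (i%:Z))).

Definition k_op (i : nat) : X -> X :=
  if i == 1%N then M (-1) \o M (-1) \o Mi 1 \o Mi 1
  else M (- (i%:Z)) \o Mi (1 - i%:Z) \o M (i%:Z - 1) \o Mi (i%:Z).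

Definition kinv_op (i : nat) : X -> X :=
  if i == 1%N then Mi (-1) \o Mi (-1) \o M 1 \o M 1
  else Mi (- (i%:Z)) \o M (1 - i%:Z) \o Mi (i%:Z - 1) \o M (i%:Z).

Definition serre_sum (E : nat -> X -> X) (i j : nat) : X -> X :=
  fun v => \sum_(t < (serre_deg i j).+1)
    ((-1) ^+ t * qbinom (qi q i) (serre_deg i j) t) *:
      (iter t (E i) (E j (iter (serre_deg i j - t) (E i) v))).

Definition Uq_relations (E Fo K Ki : nat -> X -> X) : Prop :=
  forall i j : nat, (1 <= i <= n)%N -> (1 <= j <= n)%N ->
  (K i \o K j = K j \o K i) /\
  (K i \o Ki i = id /\ Ki i \o K i = id) /\
  (K i \o E j \o Ki i = opZ (qi q i ^ cartan i j) (E j)) /\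
  (K i \o Fo j \o Ki i = opZ (qi q i ^ (- cartan i j)) (Fo j)) /\
  (opD (E i \o Fo j) (opN (Fo j \o E i)) =
     (if i == j then opZ ((qi q i - (qi q i)^-1)^-1) (opD (K i) (opN (Ki i)))
      else op0)) /\
  (i != j -> serre_sum E i j = op0 /\ serre_sum Fo i j = op0).

End QSymp.

(* Main.v *)
(* Write up_k for the operator x^a |-> x^(a + eps_k). Up to the tau-factors this is
   left multiplication by x_k for k < 0 and right multiplication by x_k for k > 0,
   so e_i and f_i with i > 1 are expressions in up_k, d_k, mu_k for k = +-i, +-(i-1).
   In e_1 one multiplies by x_(-1) on the other side as well, and the relation
   between x_1 and x_(-1) produces an extra term: W_2 d_1^2 up to mu-factors, where
   W_i = up_(-i) up_i + q W_(i+1) mu_(-i) mu_i describes the insertion of Omega_i into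
   a normal monomial, and W_(i+1) commutes with up_k, d_k, mu_k for |k| <= i.
   Hence the relations between generators with equal or adjacent indices only involve
   at most six of the exponents, together with one commuting operator W_j. They are
   identities between q-difference operators in these exponents, i.e. in a quantum
   torus of rank 7 over the integers, where they are decided by computing normal
   forms. For distant indices all relations reduce to commutation of operators acting
   on disjoint sets of exponents, the only exception being W_2 in e_1 and f_1, which
   is handled by descending induction along the recursion for W_i. *)

Require Import Defs.
From Stdlib Require Import FunctionalExtensionality.
From HB Require Import structures.
From mathcomp Require Import all_boot all_order all_algebra.
From mathcomp Require Import zify ring.
Set Implicit Arguments.
Unset Strict Implicit.
Unset Printing Implicit Defensive.
Import Order.TTheory GRing.Theory Num.Theory.
Local Open Scope ring_scope.

(** * The quantum torus *)

Fixpoint vadd (s t : seq int) : seq int :=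
  match s, t with
  | [::], _ => t
  | _, [::] => s
  | x :: s', y :: t' => (x + y) :: vadd s' t'
  end.

Fixpoint vdot (s t : seq int) : int :=
  match s, t with
  | x :: s', y :: t' => x * y + vdot s' t'
  | _, _ => 0
  end.

Fixpoint pairing (s : seq int) (z : nat -> int) : int :=
  if s is c :: s' then c * z 0%N + pairing s' (fun j => z j.+1) else 0.

Definition translate (s : seq int) (z : nat -> int) : nat -> int :=
  fun j => z j + s`_j.

(* The term (m, (e, (alpha, s))) stands for the operator
   phi |-> (z |-> m q^(e + alpha.z) phi (z + s)). *)
Definition tterm : Type := int * (int * (seq int * seq int)).

(** The term [g] shifts the exponents before the coefficient q^(alpha.z) of [f] is read off at z +
    s; this is the source of the twist [vdot]. *)
Definition tmul1 (f g : tterm) : tterm :=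
  (f.1 * g.1, (f.2.1 + g.2.1 + vdot f.2.2.1 g.2.2.2,
    (vadd f.2.2.1 g.2.2.1, vadd f.2.2.2 g.2.2.2))).

Fixpoint lexleq (s t : seq int) : bool :=
  match s, t with
  | [::], _ => true
  | _, [::] => false
  | x :: s', y :: t' => (x < y) || (x == y) && lexleq s' t'
  end.

Definition tleq (x y : tterm) : bool :=
  lexleq (x.2.2.2 ++ x.2.1 :: x.2.2.1) (y.2.2.2 ++ y.2.1 :: y.2.2.1).

Definition tmerge (x : tterm) (l : seq tterm) : seq tterm :=
  if l is y :: r then if x.2 == y.2 then (x.1 + y.1, x.2) :: r else x :: l else [:: x].

(* Any relation in place of tleq would be sound; tleq makes equal monomials adjacent. *)
Definition tnorm (f : seq tterm) : seq tterm :=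
  [seq x <- foldr tmerge [::] (sort tleq f) | x.1 != 0].

Definition tmul (f g : seq tterm) : seq tterm := tnorm [seq tmul1 x y | x <- f, y <- g].

Definition topp (f : seq tterm) : seq tterm := [seq (- x.1, x.2) | x <- f].

Definition tnull (f : seq tterm) : bool := nilp (tnorm f).

(** Slot 0 is reserved for the commuting operator W_j and slots 1 to 6 for exponents. All vectors
    have the same length, so that equal monomials are equal as data. *)
Definition vec (j : nat) (c : int) : seq int :=
  mkseq (fun i => if i == j then c else 0) 7.

Definition tconst (l : seq (int * int)) : seq tterm :=
  [seq (x.1, (x.2, (vec 0 0, vec 0 0))) | x <- l].
Definition tU j : seq tterm := [:: (1, (0, (vec j 0, vec j 1)))].
Definition tM j : seq tterm := [:: (1, (0, (vec j 1, vec j 0)))].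
Definition tMi j : seq tterm := [:: (1, (0, (vec j (-1), vec j 0)))].
(** The coefficient q^(z_j) - q^(-z_j) is that of lambda d_j: clearing the denominator of the
    q-integer keeps all coefficients integral. *)
Definition tD j : seq tterm :=
  [:: (1, (0, (vec j 1, vec j (-1)))); (-1, (0, (vec j (-1), vec j (-1))))].

Lemma pairing_vadd s t z : pairing (vadd s t) z = pairing s z + pairing t z.
Proof.
elim: s t z => [|x s IH] [|y t] z /=; rewrite ?add0r ?addr0 //.
by rewrite IH; ring.
Qed.

Lemma pairing_translate s t z : pairing s (translate t z) = pairing s z + vdot s t.
Proof.
elim: s t z => [|x s IH] [|y t] z //=.
  have -> : translate [::] z = z.
    by apply: functional_extensionality => j; rewrite /translate nth_nil addr0.
  by rewrite addr0.
rewrite -[fun j => _]/(translate t (fun j => z j.+1)) IH /translate /=.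
by ring.
Qed.

Lemma nth_vadd s t j : (vadd s t)`_j = s`_j + t`_j.
Proof.
elim: s t j => [|x s IH] [|y t] [|j] //=; rewrite ?nth_nil ?addr0 ?add0r //.
Qed.

Lemma translate_translate s t z : translate s (translate t z) = translate (vadd s t) z.
Proof.
apply: functional_extensionality => j.
by rewrite /translate nth_vadd; ring.
Qed.

Lemma nth_vec j c i : (j < 7)%N -> (vec j c)`_i = if i == j then c else 0.
Proof.
move=> hj; case: (ltnP i 7) => hi; first by rewrite nth_mkseq.
rewrite nth_default ?size_mkseq //; case: eqP => // e; lia.
Qed.

Lemma vec0 j : vec j 0 = nseq 7 0.
Proof. by rewrite /vec /mkseq /= !if_same. Qed.

Lemma pairing_nseq m c z : c = 0 -> pairing (nseq m c) z = 0.
Proof. by move=> ->; elim: m z => //= m IH z; rewrite mul0r IH. Qed.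

Lemma translate_vec0 j z : translate (vec j 0) z = z.
Proof.
apply: functional_extensionality => i.
by rewrite /translate vec0 nth_nseq if_same addr0.
Qed.

Lemma pairing_vec j c z : (j < 7)%N -> pairing (vec j c) z = c * z j.
Proof. by case: j => [|[|[|[|[|[|[|//]]]]]]] _ /=; rewrite !mul0r ?add0r ?addr0. Qed.

Lemma pairing_vec0 j z : pairing (vec j 0) z = 0.
Proof. by rewrite vec0 pairing_nseq. Qed.

Definition nneg (z : nat -> int) : Prop := forall j, 0 <= z j.

(** * Linear maps on an algebra *)

Section LinearMaps.
Variables (F : fieldType) (V : algType F).
Implicit Types T S : V -> V.

Lemma lin_comp T S : linear T -> linear S -> linear (T \o S).
Proof. by move=> hT hS a u v /=; rewrite hS hT. Qed.

Lemma lin_opD T S : linear T -> linear S -> linear (opD T S).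
Proof. by move=> hT hS a u v; rewrite /opD hT hS scalerDr addrACA. Qed.

Lemma lin_opN T : linear T -> linear (opN T).
Proof. by move=> hT a u v; rewrite /opN hT opprD scalerN. Qed.

Lemma lin_opZ c T : linear T -> linear (opZ c T).
Proof. by move=> hT a u v; rewrite /opZ hT scalerDr !scalerA mulrC. Qed.

Lemma lin_id : linear (@id V).
Proof. by []. Qed.

Lemma lin_op0 : linear (@op0 F V).
Proof. by move=> a u v; rewrite /op0 scaler0 addr0. Qed.

Lemma lin_iter k T : linear T -> linear (iter k T).
Proof. by move=> hT; elim: k => //= k IH; apply: lin_comp. Qed.

Lemma linD T u v : linear T -> T (u + v) = T u + T v.
Proof. by move=> hT; rewrite -[u]scale1r hT !scale1r. Qed.

Lemma lin0 T : linear T -> T 0 = 0.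
Proof. by move=> hT; apply: (addIr (T 0)); rewrite -linD // !add0r. Qed.

Lemma linZ T c v : linear T -> T (c *: v) = c *: T v.
Proof. by move=> hT; rewrite -[c *: v]addr0 hT lin0 // addr0. Qed.

Lemma linN T v : linear T -> T (- v) = - T v.
Proof. by move=> hT; rewrite -scaleN1r linZ // scaleN1r. Qed.

Lemma lin_sum (I : Type) (r : seq I) (c : I -> F) (w : I -> V) T : linear T ->
  T (\sum_(i <- r) c i *: w i) = \sum_(i <- r) c i *: T (w i).
Proof.
move=> hT; elim: r => [|i r IH]; first by rewrite !big_nil lin0.
by rewrite !big_cons hT IH.
Qed.

End LinearMaps.

(** * Action of the quantum torus on functions of the exponents *)

Section QuantumTorus.
Variables (F : fieldType) (q : F).
Hypothesis q0 : q != 0.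

(** The pairs are the coefficients and exponents of an integral Laurent polynomial, evaluated at
    q. *)
Definition lval (l : seq (int * int)) : F := \sum_(x <- l) x.1%:~R * q ^ x.2.

Section Action.
Variable (V : lmodType F).
Implicit Types (f g : seq tterm) (phi : (nat -> int) -> V) (z : nat -> int).

Definition coef (x : tterm) z : F := x.1%:~R * q ^ (x.2.1 + pairing x.2.2.1 z).

Definition act f phi z : V :=
  \sum_(x <- f) coef x z *: phi (translate x.2.2.2 z).

Lemma act_cat f g phi z : act (f ++ g) phi z = act f phi z + act g phi z.
Proof. exact: big_cat. Qed.

Lemma act_topp f phi z : act (topp f) phi z = - act f phi z.
Proof.
rewrite /act big_map -sumrN; apply: eq_bigr => x _.
by rewrite /coef /= mulrNz mulNr scaleNr.
Qed.

Lemma act_tmerge x f phi z : act (tmerge x f) phi z = act (x :: f) phi z.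
Proof.
case: f => //= y r; case: eqP => // e.
by rewrite /act !big_cons addrA /coef /= -e -scalerDl intrD mulrDl.
Qed.

Lemma act_tnorm f phi z : act (tnorm f) phi z = act f phi z.
Proof.
transitivity (act (foldr tmerge [::] (sort tleq f)) phi z).
  rewrite /act big_filter big_mkcond; apply: eq_bigr => x _.
  by case: eqP => // x0; rewrite /coef x0 mul0r scale0r.
transitivity (act (sort tleq f) phi z); last by apply: perm_big; rewrite perm_sort.
elim: (sort _ _) => //= x r IH.
by rewrite act_tmerge /act !big_cons -/(act _ _ _) IH.
Qed.

Lemma act_tnull f phi z : tnull f -> act f phi z = 0.
Proof. by move=> /nilP h; rewrite -act_tnorm h /act big_nil. Qed.

(** The order is reversed because operators on the algebra are recorded through their effect on the
    index z. With this convention a composition T S is represented by the product in the same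
    order. *)
Lemma act_tmul f g phi z : act (tmul f g) phi z = act g (act f phi) z.
Proof.
rewrite /tmul act_tnorm /act big_allpairs_dep exchange_big /=; apply: eq_bigr => y _.
rewrite scaler_sumr; apply: eq_bigr => x _.
rewrite scalerA translate_translate; congr (_ *: _).
rewrite /coef /= pairing_vadd pairing_translate.
rewrite intrM !expfzDr //; ring.
Qed.

(* Operators such as tD j only make sense on functions of exponents >= 0
   because the coefficient of every term leaving this range vanishes. *)
Definition causal f : Prop := forall phi phi',
  (forall z, nneg z -> phi z = phi' z) ->
  forall z, nneg z -> act f phi z = act f phi' z.

Lemma causal_forward (x : tterm) : (forall j, 0 <= x.2.2.2`_j) -> causal [:: x].
Proof.
move=> h phi phi' e z hz; rewrite /act !big_seq1 e // => j.
by rewrite /translate addr_ge0.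
Qed.

End Action.

Section Representation.
Variables (V : algType F) (I : Type) (psi : I -> (nat -> int) -> V).

(** The equation is asked for exponents >= 0 only. Causality is carried along so that
    representations can be composed although single terms may leave this range. *)
Definition rep (T : V -> V) (f : seq tterm) : Prop :=
  [/\ linear T, causal V f
    & forall a z, nneg z -> T (psi a z) = act f (psi a) z].

Lemma rep_comp T S f g : rep T f -> rep S g -> rep (T \o S) (tmul f g).
Proof.
move=> [lT cT eT] [lS cS eS]; split; first exact: lin_comp.
  by move=> p p' e z hz; rewrite !act_tmul; apply: cS => // y hy; apply: cT.
move=> a z hz /=; rewrite eS // act_tmul lin_sum //.
(* The equation for [T] is known at nonnegative points only; causality of [g] allows it to be
   substituted under the shifts of [g]. *)
by rewrite -/(act g (fun y => T (psi a y)) z); apply: cS => // y hy; apply: eT.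
Qed.

Lemma rep_add T S f g : rep T f -> rep S g -> rep (opD T S) (f ++ g).
Proof.
move=> [lT cT eT] [lS cS eS]; split; first exact: lin_opD.
  by move=> p p' e z hz; rewrite !act_cat (cT p p') // (cS p p').
by move=> a z hz; rewrite act_cat /opD eT // eS.
Qed.

Lemma rep_opp T f : rep T f -> rep (opN T) (topp f).
Proof.
move=> [lT cT eT]; split; first exact: lin_opN.
  by move=> p p' e z hz; rewrite !act_topp (cT p p').
by move=> a z hz; rewrite act_topp /opN eT.
Qed.

Lemma rep_const l : rep (opZ (lval l) id) (tconst l).
Proof.
split; first exact/lin_opZ/lin_id.
  move=> p p' e z hz; rewrite /act /tconst !big_map; apply: eq_bigr => x _.
  by rewrite translate_vec0 e.
move=> a z hz; rewrite /opZ /lval /act /tconst big_map scaler_suml.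
by apply: eq_bigr => x _; rewrite translate_vec0 /coef pairing_vec0 addr0.
Qed.

Lemma rep_scale c l T f : c = lval l -> rep T f -> rep (opZ c T) (tmul (tconst l) f).
Proof. by move=> -> hT; apply: (rep_comp (rep_const l) hT). Qed.

Lemma rep_id : rep id (tconst [:: (1, 0)]).
Proof.
have [l c e] := rep_const [:: (1, 0)]; split=> // a z hz.
by rewrite -e // /opZ /lval big_seq1 mulr1 scale1r.
Qed.

Lemma rep_up T j : (j < 7)%N -> linear T ->
  (forall a z, nneg z -> T (psi a z) = psi a (translate (vec j 1) z)) ->
  rep T (tU j).
Proof.
move=> hj lT e; split=> //.
  by apply: causal_forward => i; rewrite nth_vec //; case: ifP.
by move=> a z hz; rewrite e // /act big_seq1 /coef pairing_vec0 mulr1 scale1r.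
Qed.

Lemma rep_mu T j : (j < 7)%N -> linear T ->
  (forall a z, nneg z -> T (psi a z) = q ^ z j *: psi a z) -> rep T (tM j).
Proof.
move=> hj lT e; split=> //.
  by apply: causal_forward => i; rewrite nth_vec //; case: ifP.
move=> a z hz; rewrite e // /act big_seq1 /coef pairing_vec // translate_vec0.
by rewrite !mul1r add0r.
Qed.

Lemma rep_muinv T j : (j < 7)%N -> linear T ->
  (forall a z, nneg z -> T (psi a z) = q ^ (- z j) *: psi a z) -> rep T (tMi j).
Proof.
move=> hj lT e; split=> //.
  by apply: causal_forward => i; rewrite nth_vec //; case: ifP.
move=> a z hz; rewrite e // /act big_seq1 /coef pairing_vec // translate_vec0.
by rewrite !mul1r add0r mulN1r.
Qed.

Lemma act_tD j (phi : (nat -> int) -> V) z : (j < 7)%N ->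
  act (tD j) phi z = (q ^ z j - q ^ (- z j)) *: phi (translate (vec j (-1)) z).
Proof.
move=> hj; rewrite /act big_cons big_seq1 -scalerDl /coef /=.
by rewrite -![_ + (_ + _)]/(pairing (vec _ _) z) !pairing_vec // !add0r !mul1r mulN1r mulN1r.
Qed.

Lemma rep_down T j : (j < 7)%N -> linear T ->
  (forall a z, nneg z ->
    T (psi a z) = (q ^ z j - q ^ (- z j)) *: psi a (translate (vec j (-1)) z)) ->
  rep T (tD j).
Proof.
move=> hj lT e; split=> //; last by move=> a z hz; rewrite act_tD // e.
(* At z_j = 0 the shift leaves the range, but the coefficient is 1 - 1 = 0. *)
move=> p p' epp z hz; rewrite !act_tD //; have [z0|z0] := eqVneq (z j) 0.
  by rewrite z0 oppr0 subrr !scale0r.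
rewrite epp // => i; rewrite /translate nth_vec //; case: eqP => [->|_].
  by have := hz j; lia.
by rewrite addr0.
Qed.

(** Soundness of the decision procedure: [tnull] is a computation over the integers with q formal,
    hence valid for every field and every nonzero q. *)
Lemma rep_eq T S f g a z : rep T f -> rep S g -> tnull (f ++ topp g) ->
  nneg z -> T (psi a z) = S (psi a z).
Proof.
move=> [_ _ eT] [_ _ eS] h hz; apply/eqP; rewrite -subr_eq0 eT // eS //.
by rewrite -act_topp -act_cat act_tnull.
Qed.

End Representation.
End QuantumTorus.

(** * Normal monomials and raising operators *)

Definition incr (a : int -> nat) (i : int) : int -> nat :=
  fun j => if j == i then (a j).+1 else a j.

Definition negs (n i : nat) : seq int := [seq - (k%:Z) | k <- rev (iota i (n.+1 - i))].
Definition poss (n i : nat) : seq int := [seq k%:Z | k <- iota i (n.+1 - i)].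

Lemma negsS n i : (i <= n)%N -> negs n i = rcons (negs n i.+1) (- i%:Z).
Proof. by move=> h; rewrite /negs subSS subSn //= rev_cons map_rcons. Qed.

Lemma possS n i : (i <= n)%N -> poss n i = i%:Z :: poss n i.+1.
Proof. by move=> h; rewrite /poss subSS subSn. Qed.

Lemma mem_negs n i k : (0 < i)%N -> (k \in negs n i) = (k < 0) && (i <= absz k <= n)%N.
Proof.
move=> i0; apply/mapP/idP => [[m]|h].
  by rewrite mem_rev mem_iota => h ->; lia.
by exists (absz k); [rewrite mem_rev mem_iota; lia | lia].
Qed.

Lemma mem_poss n i k : (0 < i)%N -> (k \in poss n i) = (0 < k) && (i <= absz k <= n)%N.
Proof.
move=> i0; apply/mapP/idP => [[m]|h].
  by rewrite mem_iota => h ->; lia.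
by exists (absz k); [rewrite mem_iota; lia | lia].
Qed.

Lemma mem_Iseq n k : (k \in Iseq n) = inI n k.
Proof.
have -> : Iseq n = negs n 1 ++ poss n 1 by rewrite /negs /poss subn1.
by rewrite mem_cat mem_negs // mem_poss // /inI; lia.
Qed.

Lemma Iseq_split n i : (1 <= i <= n.+1)%N -> Iseq n = negs n i ++ Iseq i.-1 ++ poss n i.
Proof.
move=> h; have e : iota 1 n = iota 1 i.-1 ++ iota i (n.+1 - i).
  have := iotaD 1 i.-1 (n.+1 - i).
  have -> : (i.-1 + (n.+1 - i) = n)%N by lia.
  by have -> : (1 + i.-1 = i)%N by lia.
by rewrite /Iseq e rev_cat !map_cat -!catA.
Qed.

Lemma Iseq_center n i : (1 <= i <= n)%N ->
  Iseq n = negs n i.+1 ++ - i%:Z :: Iseq i.-1 ++ i%:Z :: poss n i.+1.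
Proof.
move=> /andP[i0 h]; rewrite (@Iseq_split n i) ?i0 ?(leqW h) //.
by rewrite (negsS h) (possS h) cat_rcons.
Qed.

(** * Ordered products of q-commuting elements *)

Section OrderedProducts.
Variables (F : fieldType) (X : algType F) (q : F) (x : int -> X).

Definition opr (s : seq int) (a : int -> nat) : X := \prod_(i <- s) x i ^+ a i.

Definition deg (s : seq int) (a : int -> nat) : nat := \sum_(i <- s) a i.

Lemma opr_cat s t a : opr (s ++ t) a = opr s a * opr t a.
Proof. exact: big_cat. Qed.

Lemma opr_cons k s a : opr (k :: s) a = x k ^+ a k * opr s a.
Proof. exact: big_cons. Qed.

Lemma eq_opr s a b : {in s, a =1 b} -> opr s a = opr s b.
Proof. by move=> h; rewrite /opr !big_seq; apply: eq_bigr => i /h ->. Qed.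

Lemma eq_deg s a b : {in s, a =1 b} -> deg s a = deg s b.
Proof. by move=> h; rewrite /deg !big_seq; apply: eq_bigr => i /h ->. Qed.

Lemma opr_incr s a k : k \notin s -> opr s (incr a k) = opr s a.
Proof. by move=> h; apply: eq_opr => i hi; rewrite /incr; case: eqP h hi => // -> /negP. Qed.

Lemma deg_incr s a k : k \notin s -> deg s (incr a k) = deg s a.
Proof. by move=> h; apply: eq_deg => i hi; rewrite /incr; case: eqP h hi => // -> /negP. Qed.

Lemma qcomm_exp (c : F) (y z : X) m : y * z = c *: (z * y) ->
  y * z ^+ m = c ^+ m *: (z ^+ m * y).
Proof.
move=> h; elim: m => [|m IH]; first by rewrite !expr0 scale1r mulr1 mul1r.
rewrite exprS mulrA h -scalerAl -[z * y * _]mulrA IH -scalerAr scalerA mulrA.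
by rewrite [c ^+ m.+1]exprS.
Qed.

Lemma expr_qcomm (c : F) (y z : X) m : z * y = c *: (y * z) ->
  z ^+ m * y = c ^+ m *: (y * z ^+ m).
Proof.
move=> h; elim: m => [|m IH]; first by rewrite !expr0 scale1r mulr1 mul1r.
rewrite exprSr -mulrA h -scalerAr [z ^+ m * (y * z)]mulrA IH -scalerAl scalerA -mulrA.
by rewrite exprS.
Qed.

Lemma qcomm_opr y s a : (forall k, k \in s -> y * x k = q *: (x k * y)) ->
  y * opr s a = q ^+ deg s a *: (opr s a * y).
Proof.
elim: s => [|k s IH] h; first by rewrite /opr /deg !big_nil scale1r mulr1 mul1r.
rewrite opr_cons mulrA (qcomm_exp _ (h k _)) ?mem_head // -scalerAl.
rewrite -[x k ^+ _ * y * _]mulrA IH; last first.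
  by move=> l hl; apply: h; rewrite in_cons hl orbT.
by rewrite -scalerAr scalerA mulrA /deg big_cons exprD.
Qed.

Lemma opr_qcomm y s a : (forall k, k \in s -> x k * y = q *: (y * x k)) ->
  opr s a * y = q ^+ deg s a *: (y * opr s a).
Proof.
elim: s => [|k s IH] h; first by rewrite /opr /deg !big_nil scale1r mulr1 mul1r.
rewrite opr_cons -mulrA IH; last by move=> l hl; apply: h; rewrite in_cons hl orbT.
rewrite -scalerAr [x k ^+ _ * (y * _)]mulrA (expr_qcomm _ (h k _)) ?mem_head //
  -scalerAl scalerA -mulrA.
by rewrite /deg big_cons exprD mulrC.
Qed.

End OrderedProducts.

(** * Commutation rules in the quantum symplectic space *)

Section SymplecticSpace.
Variables (F : fieldType) (q : F) (q0 : q != 0) (n : nat) (X : algType F) (x : int -> X).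
Hypothesis rel1 : forall i j : int, inI n i -> inI n j -> i < j -> j != - i ->
  x j * x i = q *: (x i * x j).
Hypothesis rel2 : forall i : nat, (1 <= i <= n)%N ->
  x (i%:Z) * x (- (i%:Z)) =
    q ^+ 2 *: (x (- (i%:Z)) * x (i%:Z)) + (q ^+ 2 * (q - q^-1)) *: Omega q n x i.+1.

Notation Om := (Omega q n x).
Notation opr := (opr x).

Lemma Omega_rec i : (i <= n)%N ->
  Om i = x (- i%:Z) * x i%:Z + q *: Om i.+1.
Proof.
move=> h; rewrite /Omega big_ltn // subnn scale1r; congr (_ + _).
rewrite scaler_sumr !big_nat; apply: eq_bigr => j hj.
by rewrite scalerA -exprS; congr (q ^+ _ *: _); lia.
Qed.

Lemma Omega_last : Om n.+1 = 0.
Proof. by rewrite /Omega big_geq. Qed.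

(** In each summand, moving x_k to the right past x_(-j) costs q and past x_j costs q^-1, so the two
    factors cancel. *)
Lemma comm_Omega k i : inI n k -> (absz k < i)%N -> GRing.comm (x k) (Om i).
Proof.
move=> hk hi; rewrite /Omega big_nat; apply: big_ind.
- exact: commr0.
- by move=> u v; apply: commrD.
move=> j hj; rewrite /GRing.comm -scalerAr -scalerAl; congr (_ *: _).
have h1 : x k * x (- j%:Z) = q *: (x (- j%:Z) * x k) by apply: rel1; rewrite /inI in hk *; lia.
have h2 : x j * x k = q *: (x k * x j) by apply: rel1; rewrite /inI in hk *; lia.
by rewrite mulrA h1 -scalerAl -!mulrA h2 -scalerAr.
Qed.

(** Each of the c + 1 exchanges leaves a multiple of Omega_(i+1), which commutes with x_i. The
    coefficient is the geometric sum of (q^3 - q) q^(2l) over l <= c. *)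
Lemma exp_rel2 i c : (1 <= i <= n)%N ->
  x i%:Z ^+ c.+1 * x (- i%:Z) = (q ^+ 2) ^+ c.+1 *: (x (- i%:Z) * x i%:Z ^+ c.+1)
    + (q * (q ^+ 2) ^+ c.+1 - q) *: (Om i.+1 * x i%:Z ^+ c).
Proof.
move=> hi; have hc : GRing.comm (x i%:Z) (Om i.+1) by apply: comm_Omega; rewrite /inI; lia.
have e : q ^+ 2 * (q - q^-1) = q * q ^+ 2 - q by field.
elim: c => [|c IH]; first by rewrite !expr1 expr0 mulr1 rel2 // e.
rewrite [x i%:Z ^+ c.+2]exprS -mulrA IH mulrDr -!scalerAr [x i%:Z * (x (- _) * _)]mulrA.
rewrite rel2 // mulrDl -!scalerAl.
rewrite -[x (- _) * _ * _]mulrA -exprS scalerDr -addrA scalerA -exprSr; congr (_ + _).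
rewrite [x i%:Z * _]mulrA hc -[Om _ * _ * _]mulrA -exprS scalerA -scalerDl e; congr (_ *: _).
by rewrite [_ ^+ c.+2]exprS; ring.
Qed.

Lemma rel2_exp i c : (1 <= i <= n)%N ->
  x i%:Z * x (- i%:Z) ^+ c.+1 = (q ^+ 2) ^+ c.+1 *: (x (- i%:Z) ^+ c.+1 * x i%:Z)
    + (q * (q ^+ 2) ^+ c.+1 - q) *: (Om i.+1 * x (- i%:Z) ^+ c).
Proof.
move=> hi; have hc : GRing.comm (x (- i%:Z)) (Om i.+1) by apply: comm_Omega; rewrite /inI; lia.
have e : q ^+ 2 * (q - q^-1) = q * q ^+ 2 - q by field.
elim: c => [|c IH]; first by rewrite !expr1 expr0 mulr1 rel2 // e.
rewrite [x (- i%:Z) ^+ c.+2]exprSr mulrA IH mulrDl -!scalerAl.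
rewrite -[x (- i%:Z) ^+ _ * x i%:Z * x (- i%:Z)]mulrA rel2 // mulrDr -!scalerAr.
rewrite [x (- i%:Z) ^+ _ * (x (- i%:Z) * x i%:Z)]mulrA -exprSr scalerDr -addrA scalerA -exprSr;
  congr (_ + _).
rewrite -(commrX c.+1 (commr_sym hc)) -[Om _ * _ * _]mulrA -exprSr scalerA -scalerDl e;
  congr (_ *: _).
by rewrite [_ ^+ c.+2]exprS; ring.
Qed.

Notation mono := (mono n x).

Lemma mono_opr a : mono a = opr (Iseq n) a.
Proof. by []. Qed.

Lemma incr_neg a i : (0 < i)%N ->
  [/\ incr a i%:Z i%:Z = (a i%:Z).+1, incr a i%:Z (- i%:Z) = a (- i%:Z),
      incr a (- i%:Z) i%:Z = a i%:Z & incr a (- i%:Z) (- i%:Z) = (a (- i%:Z)).+1].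
Proof. by move=> h; rewrite /incr !eqxx; split=> //; case: eqP => //; lia. Qed.

Lemma mono_center i a : (1 <= i <= n)%N ->
  mono a = opr (negs n i.+1) a * (x (- i%:Z) ^+ a (- i%:Z) *
    (opr (Iseq i.-1) a * (x i%:Z ^+ a i%:Z * opr (poss n i.+1) a))).
Proof. by move=> h; rewrite mono_opr (Iseq_center h) opr_cat opr_cons opr_cat opr_cons. Qed.

Lemma opr_incr_out i k a : (1 <= i <= n)%N -> k = i%:Z \/ k = - i%:Z ->
  [/\ opr (negs n i.+1) (incr a k) = opr (negs n i.+1) a,
      opr (Iseq i.-1) (incr a k) = opr (Iseq i.-1) a &
      opr (poss n i.+1) (incr a k) = opr (poss n i.+1) a].
Proof.
move=> hi hk; split; apply: opr_incr.
- rewrite mem_negs //; lia.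
- rewrite mem_Iseq /inI; lia.
- rewrite mem_poss //; lia.
Qed.

Lemma mono_incr_pos i a : (1 <= i <= n)%N ->
  mono (incr a i%:Z) = opr (negs n i.+1) a * (x (- i%:Z) ^+ a (- i%:Z) *
    (opr (Iseq i.-1) a * (x i%:Z ^+ (a i%:Z).+1 * opr (poss n i.+1) a))).
Proof.
move=> hi; rewrite (mono_center _ hi).
have [-> -> ->] := @opr_incr_out i i%:Z a hi (or_introl erefl).
by case/andP: hi => /(incr_neg a) [-> -> _ _].
Qed.

Lemma mono_incr_neg i a : (1 <= i <= n)%N ->
  mono (incr a (- i%:Z)) = opr (negs n i.+1) a * (x (- i%:Z) ^+ (a (- i%:Z)).+1 *
    (opr (Iseq i.-1) a * (x i%:Z ^+ a i%:Z * opr (poss n i.+1) a))).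
Proof.
move=> hi; rewrite (mono_center _ hi).
have [-> -> ->] := @opr_incr_out i (- i%:Z) a hi (or_intror erefl).
by case/andP: hi => /(incr_neg a) [_ _ -> ->].
Qed.

(** * Raising and lowering operators on normal monomials *)

Hypothesis span : forall v : X, exists (m : nat) (a : 'I_m -> int -> nat) (c : 'I_m -> F),
  v = \sum_(k < m) c k *: mono (a k).
Variables (D M Mi : int -> X -> X).
Hypotheses (Dlin : forall i, linear (D i)) (Mlin : forall i, linear (M i))
  (Milin : forall i, linear (Mi i)).
Hypothesis D_mono : forall i a, inI n i ->
  D i (mono a) = qint q (a i) *: mono (decr a i).
Hypothesis M_mono : forall i a, inI n i -> M i (mono a) = q ^+ a i *: mono a.
Hypothesis Mi_mono : forall i a, inI n i -> Mi i (mono a) = q ^- a i *: mono a.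

Lemma mono_ext (T S : X -> X) : linear T -> linear S ->
  (forall a, T (mono a) = S (mono a)) -> T =1 S.
Proof.
move=> lT lS e v; have [m [a [c ->]]] := span v.
by rewrite !lin_sum //; apply: eq_bigr => k _; rewrite e.
Qed.

Lemma lin_xL k : linear (xL x k).
Proof. by move=> a u v; rewrite /xL mulrDr scalerAr. Qed.

Lemma lin_xR k : linear (xR x k).
Proof. by move=> a u v; rewrite /xR mulrDl scalerAl. Qed.

Lemma lin_comps l : linear (comps [seq Mi k | k <- l]).
Proof. by elim: l => //= k l IH; apply: lin_comp. Qed.

Lemma comps_mono l a : (forall k, k \in l -> inI n k) ->
  comps [seq Mi k | k <- l] (mono a) = q ^- deg l a *: mono a.
Proof.
elim: l => [|k l IH] h; first by rewrite /deg big_nil expr0 invr1 scale1r.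
rewrite /= IH => [|j hj]; last by apply: h; rewrite in_cons hj orbT.
rewrite linZ // Mi_mono ?h ?mem_head // scalerA /deg big_cons exprD invfM.
by rewrite mulrC.
Qed.

Lemma tauPinvE i : tauPinv n Mi i = comps [seq Mi k | k <- poss n i].
Proof. by rewrite /tauPinv /poss -map_comp. Qed.

Lemma tauNinvE i : tauNinv n Mi i = comps [seq Mi k | k <- rev (negs n i)].
Proof. by rewrite /tauNinv /negs (map_rev _ (iota _ _)) revK -map_comp. Qed.

Lemma lin_tauP i : linear (tauPinv n Mi i).
Proof. by rewrite tauPinvE; apply: lin_comps. Qed.

Lemma lin_tauN i : linear (tauNinv n Mi i).
Proof. by rewrite tauNinvE; apply: lin_comps. Qed.

Lemma tauP_mono i a : (0 < i)%N ->
  tauPinv n Mi i (mono a) = q ^- deg (poss n i) a *: mono a.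
Proof.
by move=> i0; rewrite tauPinvE comps_mono // => k; rewrite mem_poss // /inI; lia.
Qed.

Lemma tauN_mono i a : (0 < i)%N ->
  tauNinv n Mi i (mono a) = q ^- deg (negs n i) a *: mono a.
Proof.
move=> i0; rewrite tauNinvE comps_mono => [|k]; last by rewrite mem_rev mem_negs // /inI; lia.
by rewrite /deg big_rev.
Qed.

Definition up (k : int) : X -> X :=
  match k with
  | Posz i => tauPinv n Mi i.+1 \o xR x k
  | Negz i => tauNinv n Mi i.+2 \o xL x k
  end.
Arguments up : simpl never.

Definition down (k : int) : X -> X := opZ (q - q^-1) (D k).

Lemma up_neg i : (0 < i)%N -> up (- i%:Z) = tauNinv n Mi i.+1 \o xL x (- i%:Z).
Proof. by case: i. Qed.

Lemma lin_up k : linear (up k).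
Proof.
by case: k => i; apply: lin_comp; rewrite ?lin_tauP ?lin_tauN;
   auto using lin_tauP, lin_tauN, lin_xL, lin_xR.
Qed.

Lemma lin_down k : linear (down k).
Proof. exact: lin_opZ. Qed.

(** Multiplying from the side nearer to x_k, the new factor only crosses variables x_j with |j| >
    |k| of the same sign. This never meets x_(-k), and the tau-factor cancels the resulting power of
    q. *)
Lemma up_mono k a : inI n k -> up k (mono a) = mono (incr a k).
Proof.
have [i [-> | ->]] : exists i : nat, k = i%:Z \/ k = - i%:Z.
- by exists (absz k); lia.
- move=> hk; have hi : (1 <= i <= n)%N by rewrite /inI in hk; lia.
  rewrite /up /= /xR (mono_center _ hi) -!mulrA (@opr_qcomm _ _ q _ _ (poss n i.+1)); last first.
    by move=> j; rewrite mem_poss // => hj; apply: rel1; rewrite /inI; lia.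
  rewrite -!scalerAr linZ; last exact: lin_tauP.
  rewrite [x _ ^+ a i%:Z * _]mulrA -exprSr -(mono_incr_pos _ hi) tauP_mono //.
  rewrite deg_incr ?scalerA ?mulfV ?scale1r ?expf_neq0 //.
  by rewrite mem_poss //; lia.
move=> hk; have hi : (1 <= i <= n)%N by rewrite /inI in hk; lia.
rewrite up_neg /= /xL; last by case/andP: hi.
rewrite (mono_center _ hi) mulrA (@qcomm_opr _ _ q _ _ (negs n i.+1)); last first.
  by move=> j; rewrite mem_negs // => hj; apply: rel1; rewrite /inI; lia.
rewrite -!scalerAl linZ; last exact: lin_tauN.
rewrite -[opr _ _ * x _ * _]mulrA [x (- i%:Z) * _]mulrA -exprS -(mono_incr_neg _ hi).
rewrite tauN_mono // deg_incr ?scalerA ?mulfV ?scale1r ?expf_neq0 //.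
by rewrite mem_negs //; lia.
Qed.

Lemma down_mono k a : inI n k ->
  down k (mono a) = (q ^+ a k - q ^- a k) *: mono (decr a k).
Proof.
move=> hk; rewrite /down /opZ D_mono // scalerA /qint.
(* If q is its own inverse, both sides vanish; roots of unity are excluded only later. *)
have [e|ne] := eqVneq (q - q^-1) 0; last by rewrite mulrC divfK.
have e1 : q = q^-1 by apply/eqP; rewrite -subr_eq0 e.
by rewrite e mul0r -exprVn -e1 subrr.
Qed.
Definition upd (a : int -> nat) (k : int) (m : nat) : int -> nat :=
  fun j => if j == k then m else a j.

Lemma incrE a k : incr a k = upd a k (a k).+1.
Proof. by apply: functional_extensionality => j; rewrite /incr /upd; case: eqP => // ->. Qed.

Lemma decrE a k : decr a k = upd a k (a k).-1.
Proof. by apply: functional_extensionality => j; rewrite /decr /upd; case: eqP => // ->. Qed.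

Lemma upd_id a k : upd a k (a k) = a.
Proof. by apply: functional_extensionality => j; rewrite /upd; case: eqP => // ->. Qed.

(** * Commutation of operators acting on different exponents *)

Definition opcomm (f g : X -> X) : Prop := forall v, f (g v) = g (f v).

Lemma opcomm_sym f g : opcomm f g -> opcomm g f.
Proof. by move=> h v; rewrite h. Qed.

Lemma opcomm_comp f g h : opcomm f g -> opcomm f h -> opcomm f (g \o h).
Proof. by move=> hg hh v /=; rewrite hg hh. Qed.

Lemma opcomm_opD f g h : linear f -> opcomm f g -> opcomm f h -> opcomm f (opD g h).
Proof. by move=> lf hg hh v; rewrite /opD linD // hg hh. Qed.

Lemma opcomm_opN f g : linear f -> opcomm f g -> opcomm f (opN g).
Proof. by move=> lf hg v; rewrite /opN linN // hg. Qed.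

Lemma opcomm_opZ c f g : linear f -> opcomm f g -> opcomm f (opZ c g).
Proof. by move=> lf hg v; rewrite /opZ linZ // hg. Qed.

Definition local (T : X -> X) (k : int) : Prop :=
  linear T /\ exists (c : nat -> F) (f : nat -> nat),
    forall a, T (mono a) = c (a k) *: mono (upd a k (f (a k))).

(** Neither operator changes the exponent on which the coefficient and the update of the other
    depend. *)
Lemma opcomm_local T S k l : local T k -> local S l -> k != l -> opcomm T S.
Proof.
move=> [lT [c [f eT]]] [lS [d [g eS]]] kl.
apply: mono_ext => [||a]; [exact: lin_comp | exact: lin_comp |].
rewrite /= eT eS !linZ // eT eS !scalerA /upd (negPf kl) (eq_sym l k) (negPf kl) mulrC.
congr (_ *: mono _); apply: functional_extensionality => j.
by case: (j =P k) => // ->; rewrite (negPf kl).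
Qed.

Lemma local_up k : inI n k -> local (up k) k.
Proof.
move=> hk; split; first exact: lin_up.
by exists (fun=> 1), S => a; rewrite up_mono // scale1r incrE.
Qed.

Lemma local_down k : inI n k -> local (down k) k.
Proof.
move=> hk; split; first exact: lin_down.
by exists (fun m => q ^+ m - q ^- m), predn => a; rewrite down_mono // decrE.
Qed.

Lemma local_M k : inI n k -> local (M k) k.
Proof.
by move=> hk; split=> //; exists (fun m => q ^+ m), id => a; rewrite M_mono // upd_id.
Qed.

Lemma local_Mi k : inI n k -> local (Mi k) k.
Proof.
by move=> hk; split=> //; exists (fun m => q ^- m), id => a; rewrite Mi_mono // upd_id.
Qed.

Definition away (g : X -> X) (k : int) : Prop :=
  linear g /\ [/\ opcomm g (up k), opcomm g (down k), opcomm g (M k) & opcomm g (Mi k)].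

Lemma away_local g k l : inI n l -> local g k -> k != l -> away g l.
Proof.
move=> hl hg kl; split; first by case: hg.
split; apply: (opcomm_local hg _ kl).
- exact: local_up.
- exact: local_down.
- exact: local_M.
- exact: local_Mi.
Qed.

Lemma away_comp f g k : away f k -> away g k -> away (f \o g) k.
Proof.
move=> [lf [f1 f2 f3 f4]] [lg [g1 g2 g3 g4]]; split; first exact: lin_comp.
by split; apply/opcomm_sym/opcomm_comp; apply: opcomm_sym.
Qed.

Lemma away_opD f g k : away f k -> away g k -> away (opD f g) k.
Proof.
move=> [lf [f1 f2 f3 f4]] [lg [g1 g2 g3 g4]]; split; first exact: lin_opD.
by split; apply/opcomm_sym/opcomm_opD; rewrite ?lin_up ?lin_down //;
  try exact: opcomm_sym; auto using lin_up, lin_down.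
Qed.

Lemma away_opZ c g k : away g k -> away (opZ c g) k.
Proof.
move=> [lg [g1 g2 g3 g4]]; split; first exact: lin_opZ.
by split; apply/opcomm_sym/opcomm_opZ;
  try exact: opcomm_sym; auto using lin_up, lin_down.
Qed.

Lemma away_op0 k : away (@op0 F X) k.
Proof.
split; first exact: lin_op0.
by split=> v; rewrite /op0 lin0 //; auto using lin_up, lin_down.
Qed.

(** * Insertion of Omega_i into normal monomials *)

Fixpoint Wfrom (d : nat) : X -> X :=
  if d is d'.+1 then
    opD (up (- (n - d')%N%:Z) \o up (n - d')%N%:Z)
        (opZ q (Wfrom d' \o M (- (n - d')%N%:Z) \o M (n - d')%N%:Z))
  else @op0 F X.

(* Left multiplication by Omega_i in the middle of a normal monomial, stripped
   of the power of q that comes from the variables x_k with |k| < i. *)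
Definition W (i : nat) : X -> X := Wfrom (n.+1 - i).

(** [Wfrom] counts steps down from n + 1, so that [d'.+1] steps reach i = n - d'; this makes the
    descending recursion structural. *)
Lemma W_rec i : (1 <= i <= n)%N ->
  W i = opD (up (- i%:Z) \o up i%:Z) (opZ q (W i.+1 \o M (- i%:Z) \o M i%:Z)).
Proof.
move=> hi; rewrite /W subSS (_ : (n.+1 - i = (n - i).+1)%N) /=; last by lia.
by rewrite (_ : (n - (n - i) = i)%N) //; lia.
Qed.

Lemma W_last : W n.+1 = @op0 F X.
Proof. by rewrite /W subnn. Qed.

Lemma down_ind (P : nat -> Prop) : P n.+1 ->
  (forall i, (1 <= i <= n)%N -> P i.+1 -> P i) -> forall i, (1 <= i <= n.+1)%N -> P i.
Proof.
move=> P0 PS i hi; have [d e] : exists d, (i + d = n.+1)%N by exists (n.+1 - i)%N; lia.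
elim: d i hi e => [|d IH] i hi e; first by rewrite (_ : i = n.+1) //; lia.
by apply: PS; [lia | apply: IH; lia].
Qed.

(** Unfolding the recursion, W_i is built from operators with indices of absolute value at least
    i. *)
Lemma away_W i k : (1 <= i <= n.+1)%N -> inI n k -> (absz k < i)%N -> away (W i) k.
Proof.
move=> hi hk; move: i hi; apply: down_ind => [|i hi IH] hik.
  by rewrite W_last; apply: away_op0.
rewrite W_rec //; apply: away_opD.
  by apply: away_comp; apply: (away_local hk (local_up _)); rewrite /inI; lia.
apply: away_opZ; apply: away_comp; first apply: away_comp.
- by apply: IH; lia.
- by apply: (away_local hk (local_M _)); rewrite /inI; lia.
- by apply: (away_local hk (local_M _)); rewrite /inI; lia.
Qed.

Lemma lin_W i : linear (W i).
Proof.
rewrite /W; elim: (n.+1 - i)%N => [|d IH] /=; first exact: lin_op0.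
apply: lin_opD; first exact: (lin_comp (@lin_up _) (@lin_up _)).
by apply/lin_opZ/lin_comp => //; apply: lin_comp.
Qed.

Lemma W_mono i a : (1 <= i <= n)%N ->
  W i (mono a) = mono (incr (incr a i%:Z) (- i%:Z)) +
    (q * q ^+ a (- i%:Z) * q ^+ a i%:Z) *: W i.+1 (mono a).
Proof.
move=> hi; have [h1 h2] : inI n i%:Z /\ inI n (- i%:Z) by rewrite /inI; lia.
rewrite W_rec // /opD /opZ /= !up_mono // M_mono // (linZ _ _ (Mlin _)) M_mono //.
by rewrite !(linZ _ _ (@lin_W _)) !scalerA; congr (_ + _ *: _); ring.
Qed.

Lemma deg_possS i a : (i <= n)%N -> deg (poss n i) a = (a i%:Z + deg (poss n i.+1) a)%N.
Proof. by move=> h; rewrite (possS h) /deg big_cons. Qed.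

Lemma deg_negsS i a : (i <= n)%N -> deg (negs n i) a = (a (- i%:Z) + deg (negs n i.+1) a)%N.
Proof. by move=> h; rewrite (negsS h) /deg big_rcons addnC. Qed.

(** Every monomial in the image has degree one more in the variables x_i, ..., x_n, since each
    summand of Omega_i contributes exactly one of them. *)
Lemma tauP_W i a : (1 <= i <= n.+1)%N ->
  tauPinv n Mi i (W i (mono a)) = q ^- (deg (poss n i) a).+1 *: W i (mono a).
Proof.
move: i; apply: down_ind => [|i hi IH].
  by rewrite W_last /op0 scaler0 (lin0 (@lin_tauP _)).
have hi0 : (0 < i)%N by lia.
have hin : (i <= n)%N by lia.
have hI : inI n i%:Z by rewrite /inI; lia.
have [_ [_ _ _ cMi]] : away (W i.+1) i%:Z by apply: away_W => //; lia.
have e : deg (poss n i) (incr (incr a i%:Z) (- i%:Z)) = (deg (poss n i) a).+1.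
  rewrite !(deg_possS _ hin) !deg_incr; try by rewrite mem_poss //; lia.
  by rewrite /incr eqxx (_ : (i%:Z == - i%:Z) = false) //; lia.
rewrite W_mono // (linD _ _ (@lin_tauP _)) (linZ _ _ (@lin_tauP _)) tauP_mono //
  e (deg_possS _ hin).
rewrite tauPinvE (possS hin) /= -tauPinvE IH (linZ _ _ (Milin _)) -cMi Mi_mono //.
rewrite (linZ _ _ (@lin_W _)) scalerDr !scalerA; congr (_ + _ *: _).
by rewrite -addnS exprD invfM; ring.
Qed.

Lemma tauN_W i a : (1 <= i <= n.+1)%N ->
  tauNinv n Mi i (W i (mono a)) = q ^- (deg (negs n i) a).+1 *: W i (mono a).
Proof.
move: i; apply: down_ind => [|i hi IH].
  by rewrite W_last /op0 scaler0 (lin0 (@lin_tauN _)).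
have hi0 : (0 < i)%N by lia.
have hin : (i <= n)%N by lia.
have hI : inI n (- i%:Z) by rewrite /inI; lia.
have [_ [_ _ _ cMi]] : away (W i.+1) (- i%:Z) by apply: away_W => //; lia.
have e : deg (negs n i) (incr (incr a i%:Z) (- i%:Z)) = (deg (negs n i) a).+1.
  rewrite !(deg_negsS _ hin) !deg_incr; try by rewrite mem_negs //; lia.
  by rewrite /incr eqxx (_ : (- i%:Z == i%:Z) = false) //; lia.
rewrite W_mono // (linD _ _ (@lin_tauN _)) (linZ _ _ (@lin_tauN _)) tauN_mono //
  e (deg_negsS _ hin).
rewrite tauNinvE (negsS hin) rev_rcons /= -tauNinvE IH (linZ _ _ (Milin _)) -cMi Mi_mono //.
rewrite (linZ _ _ (@lin_W _)) scalerDr !scalerA; congr (_ + _ *: _).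
by rewrite -addnS exprD invfM; ring.
Qed.

Lemma Iseq_ends i : Iseq i.+1 = - i.+1%:Z :: Iseq i ++ [:: i.+1%:Z].
Proof. by rewrite (@Iseq_center i.+1 i.+1) ?leqnn // /negs /poss subnn. Qed.

(** The summand x_(-i) x_i is ordered by moving x_i across the inner variables, at a cost of q each.
    The rest, q Omega_(i+1), commutes with x_(-i) and is inserted one level further out, where the
    inner block has gained x_(-i) and x_i; their degrees give the mu-factors in the recursion for
    W_i. *)
Lemma Omega_insert i a : (1 <= i <= n.+1)%N ->
  opr (negs n i) a * (Om i * (opr (Iseq i.-1) a * opr (poss n i) a)) =
    q ^+ deg (Iseq i.-1) a *: W i (mono a).
Proof.
move: i; apply: down_ind => [|i hi IH].
  by rewrite W_last /op0 scaler0 Omega_last mul0r mulr0.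
have hi0 : (0 < i)%N by lia.
have hin : (i <= n)%N by lia.
have hIN : inI n (- i%:Z) by rewrite /inI; lia.
have hO : GRing.comm (x (- i%:Z)) (Om i.+1) by apply: comm_Omega => //; lia.
have hp : x i%:Z * opr (Iseq i.-1) a = q ^+ deg (Iseq i.-1) a *: (opr (Iseq i.-1) a * x i%:Z).
  apply: qcomm_opr => k; rewrite mem_Iseq => hk; apply: rel1; rewrite /inI in hk *; lia.
have [eI dI] : opr (Iseq i) a = x (- i%:Z) ^+ a (- i%:Z) * (opr (Iseq i.-1) a * x i%:Z ^+ a i%:Z)
    /\ deg (Iseq i) a = (a (- i%:Z) + (deg (Iseq i.-1) a + a i%:Z))%N.
  have -> : Iseq i = - i%:Z :: Iseq i.-1 ++ [:: i%:Z] by case: (i) hi0 => // j _;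
    apply: Iseq_ends.
  by rewrite /deg big_cons big_cat /= big_seq1 opr_cons opr_cat {2}/opr big_seq1.
rewrite Omega_rec // (negsS hin) (possS hin) opr_cons.
rewrite {1}/opr big_rcons -/(opr _ _) W_mono // scalerDr mulrDl mulrDr; congr (_ + _).
  rewrite (mono_incr_neg _ hi).
  have /= [-> -> ->] := @opr_incr_out i i%:Z a hi (or_introl erefl).
  have /andP[/(incr_neg a) [-> -> _ _] _] := hi.
  rewrite -[x _ * x _ * _]mulrA [x i%:Z * (_ * _)]mulrA hp -!scalerAl -!scalerAr.
  by rewrite exprSr exprS !mulrA.
rewrite scalerA -scalerAl -scalerAr.
(* The powers of x_(-i) and x_i are absorbed into the inner block to reach the form of the induction
   hypothesis. *)
have -> : opr (negs n i.+1) a * x (- i%:Z) ^+ a (- i%:Z) * (Om i.+1 *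
    (opr (Iseq i.-1) a * (x i%:Z ^+ a i%:Z * opr (poss n i.+1) a))) =
  opr (negs n i.+1) a * (Om i.+1 * (opr (Iseq i) a * opr (poss n i.+1) a)).
  rewrite eI -mulrA; congr (_ * _).
  by rewrite [LHS]mulrA (commr_sym (commrX _ (commr_sym hO))) -!mulrA.
by rewrite IH dI !scalerA !exprD; congr (_ *: _); ring.
Qed.

(** * Multiplication by x_1 and x_(-1) from the far side *)

Lemma opr_Iseq0 a : opr (Iseq 1.-1) a = 1.
Proof. exact: big_nil. Qed.

Lemma mono_center1 a : (0 < n)%N ->
  mono a = opr (negs n 2) a * (x (- 1%:Z) ^+ a (- 1%:Z) * (x 1%:Z ^+ a 1%:Z * opr (poss n 2) a)).
Proof. by move=> n0; rewrite (@mono_center 1) // opr_Iseq0 mul1r. Qed.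

Lemma Omega2_insert a : (0 < n)%N ->
  opr (negs n 2) a * (Om 2 * (x (- 1%:Z) ^+ a (- 1%:Z) * (x 1%:Z ^+ a 1%:Z * opr (poss n 2) a))) =
    q ^+ (a (- 1%:Z) + a 1%:Z) *: W 2 (mono a).
Proof.
move=> n0; have /= := @Omega_insert 2 a; rewrite (_ : Iseq 1 = [:: - 1%:Z; 1%:Z]) //.
by rewrite /deg !big_cons big_nil addn0 !opr_cons {2}/opr big_nil mulr1 -!mulrA => ->.
Qed.

Lemma decr_out a k s : k \notin s -> opr s (decr a k) = opr s a /\ deg s (decr a k) = deg s a.
Proof.
move=> h; have e : {in s, decr a k =1 a}.
  by move=> j hj; rewrite /decr; case: eqP hj h => // -> ->.
by split; [exact: eq_opr | exact: eq_deg].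
Qed.

(** The factor x_(-1) moves left through x_2, ..., x_n and then through the power of x_1, where
    [exp_rel2] leaves a multiple of Omega_2; that is inserted by [Omega2_insert]. *)
Lemma mono_mul_neg1 a : (0 < n)%N ->
  mono a * x (- 1%:Z) = q ^+ deg (poss n 2) a *: (q ^+ (2 * a 1%:Z) *: mono (incr a (- 1%:Z))
    + ((q * q ^+ (2 * a 1%:Z) - q) * q ^+ (a (- 1%:Z) + (a 1%:Z).-1)) *: W 2 (mono (decr a
      1%:Z))).
Proof.
move=> n0; have hP : opr (poss n 2) a * x (- 1%:Z) =
    q ^+ deg (poss n 2) a *: (x (- 1%:Z) * opr (poss n 2) a).
  by apply: opr_qcomm => k; rewrite mem_poss // => hk; apply: rel1; rewrite /inI; lia.
have hO : GRing.comm (x (- 1%:Z)) (Om 2) by apply: comm_Omega; rewrite /inI //; lia.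
rewrite mono_center1 // (@mono_incr_neg 1) // opr_Iseq0 mul1r -!mulrA hP -!scalerAr.
(* For a_1 = 0 the truncated predecessor is harmless, because its term has coefficient q - q = 0. *)
congr (_ *: _); have [ea|[c ea]] : a 1%:Z = 0%N \/ exists c, a 1%:Z = c.+1.
- by case: (a 1%:Z) => [|c]; [left | right; exists c].
- by rewrite ea expr0 muln0 expr0 mulr1 subrr mul0r scale0r addr0 scale1r !mul1r exprSr -!mulrA.
rewrite -scalerA; have -> : (a (- 1%:Z) + (a 1%:Z).-1 = decr a 1%:Z (- 1%:Z) + decr a 1%:Z
  1%:Z)%N by [].
rewrite -Omega2_insert //.
rewrite (@decr_out a 1%:Z (negs n 2) _).1 ?mem_negs //.
rewrite (@decr_out a 1%:Z (poss n 2) _).1 ?mem_poss //.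
rewrite [decr a _ _]/= /decr /= ea /= [x _ ^+ c.+1 * (x _ * _)]mulrA (@exp_rel2 1) //.
rewrite mulrDl !mulrDr -!scalerAl -!scalerAr exprM; congr (_ *: _ + _ *: _).
  by rewrite [x (- 1%:Z) ^+ _.+1]exprSr !mulrA.
by rewrite !mulrA -[_ * _ * Om 2]mulrA (commr_sym (commrX _ (commr_sym hO))) !mulrA.
Qed.

Lemma mono_pos1_mul a : (0 < n)%N ->
  x 1%:Z * mono a = q ^+ deg (negs n 2) a *: (q ^+ (2 * a (- 1%:Z)) *: mono (incr a 1%:Z)
    + ((q * q ^+ (2 * a (- 1%:Z)) - q) * q ^+ ((a (- 1%:Z)).-1 + a 1%:Z)) *:
      W 2 (mono (decr a (- 1%:Z)))).
Proof.
move=> n0; have hP : x 1%:Z * opr (negs n 2) a =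
    q ^+ deg (negs n 2) a *: (opr (negs n 2) a * x 1%:Z).
  by apply: qcomm_opr => k; rewrite mem_negs // => hk; apply: rel1; rewrite /inI; lia.
rewrite mono_center1 // (@mono_incr_pos 1) // opr_Iseq0 mul1r mulrA hP -!scalerAl -mulrA.
congr (_ *: _); have [ea|[c ea]] : a (- 1%:Z) = 0%N \/ exists c, a (- 1%:Z) = c.+1.
- by case: (a (- 1%:Z)) => [|c]; [left | right; exists c].
- by rewrite ea expr0 muln0 expr0 mulr1 subrr mul0r scale0r addr0 scale1r !mul1r exprS -!mulrA.
rewrite -scalerA.
have -> : ((a (- 1%:Z)).-1 + a 1%:Z = decr a (- 1%:Z) (- 1%:Z) + decr a (- 1%:Z) 1%:Z)%N by [].
rewrite -Omega2_insert //.
rewrite (@decr_out a (- 1%:Z) (negs n 2) _).1 ?mem_negs //.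
rewrite (@decr_out a (- 1%:Z) (poss n 2) _).1 ?mem_poss //.
rewrite [decr a _ _]/= /decr /= ea /= [x 1%:Z * (x _ ^+ c.+1 * _)]mulrA (@rel2_exp 1) //.
rewrite mulrDl !mulrDr -!scalerAl -!scalerAr exprM; congr (_ *: _ + _ *: _).
  by rewrite [x 1%:Z ^+ _.+1]exprS !mulrA.
by rewrite !mulrA.
Qed.

(** This puts the second summand of e_1 in terms of the basic operators. On the W_2 term the
    tau-factor leaves an extra q^-1 by [tauP_W], and q^(2m) - 1 = q^m (q^m - q^-m) with m = a_1
    produces [down]. *)
Lemma tauP_xR : (0 < n)%N ->
  tauPinv n Mi 2 \o xR x (- 1%:Z) =1
    opD (up (- 1%:Z) \o M 1%:Z \o M 1%:Z)
        (opZ q (W 2 \o M (- 1%:Z) \o M 1%:Z \o M 1%:Z \o down 1%:Z)).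
Proof.
move=> n0; have [p1 m1] : inI n 1%:Z /\ inI n (- 1%:Z) by rewrite /inI; lia.
apply: mono_ext => [||a].
- exact: (lin_comp (@lin_tauP _) (@lin_xR _)).
- apply: lin_opD; first exact: (lin_comp (lin_comp (@lin_up _) (Mlin _)) (Mlin _)).
  exact: (lin_opZ _ (lin_comp (lin_comp (lin_comp (lin_comp (@lin_W _) (Mlin _)) (Mlin _)) (Mlin
    _)) (lin_down _))).
have ei : deg (poss n 2) (incr a (- 1%:Z)) = deg (poss n 2) a.
  by apply: deg_incr; rewrite mem_poss.
have ed : deg (poss n 2) (decr a 1%:Z) = deg (poss n 2) a.
  by rewrite (@decr_out a 1%:Z (poss n 2) _).2 ?mem_poss.
rewrite /opD /opZ /= /xR mono_mul_neg1 // (linZ _ _ (@lin_tauP _)) (linD _ _ (@lin_tauP _)).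
rewrite !(linZ _ _ (@lin_tauP _)) tauP_mono // tauP_W // ei ed.
rewrite down_mono // !M_mono // !(linZ _ _ (Mlin _)) !M_mono // !(linZ _ _ (Mlin _)).
rewrite !M_mono // !(linZ _ _ (Mlin _)) !M_mono //
  !(linZ _ _ (@lin_up _)) !(linZ _ _ (@lin_W _)) up_mono //.
rewrite scalerDr !scalerA; congr (_ *: _ + _ *: _).
  by rewrite mul2n -addnn exprD; field; rewrite expf_neq0.
rewrite exprS /decr /=; case: (a 1%:Z) => [|c].
  by rewrite muln0 expr0 mulr1 subrr !mul0r mulr0 invr1 subrr !(mul0r, mulr0).
by rewrite mul2n -addnn !exprD /= !exprS; field; rewrite q0 !expf_neq0.
Qed.

Lemma tauN_xL : (0 < n)%N ->
  tauNinv n Mi 2 \o xL x 1%:Z =1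
    opD (up 1%:Z \o M (- 1%:Z) \o M (- 1%:Z))
        (opZ q (W 2 \o M 1%:Z \o M (- 1%:Z) \o M (- 1%:Z) \o down (- 1%:Z))).
Proof.
move=> n0; have [p1 m1] : inI n 1%:Z /\ inI n (- 1%:Z) by rewrite /inI; lia.
apply: mono_ext => [||a].
- exact: (lin_comp (@lin_tauN _) (@lin_xL _)).
- apply: lin_opD; first exact: (lin_comp (lin_comp (@lin_up _) (Mlin _)) (Mlin _)).
  exact: (lin_opZ _ (lin_comp (lin_comp (lin_comp (lin_comp (@lin_W _) (Mlin _)) (Mlin _)) (Mlin
    _)) (lin_down _))).
have ei : deg (negs n 2) (incr a 1%:Z) = deg (negs n 2) a.
  by apply: deg_incr; rewrite mem_negs.
have ed : deg (negs n 2) (decr a (- 1%:Z)) = deg (negs n 2) a.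
  by rewrite (@decr_out a (- 1%:Z) (negs n 2) _).2 ?mem_negs.
rewrite /opD /opZ /= /xL mono_pos1_mul // (linZ _ _ (@lin_tauN _)) (linD _ _ (@lin_tauN _)).
rewrite !(linZ _ _ (@lin_tauN _)) tauN_mono // tauN_W // ei ed.
rewrite down_mono // !M_mono // !(linZ _ _ (Mlin _)) !M_mono // !(linZ _ _ (Mlin _)).
rewrite !M_mono // !(linZ _ _ (Mlin _)) !M_mono //
  !(linZ _ _ (@lin_up _)) !(linZ _ _ (@lin_W _)) up_mono //.
rewrite scalerDr !scalerA; congr (_ *: _ + _ *: _).
  by rewrite mul2n -addnn exprD; field; rewrite expf_neq0.
rewrite exprS /decr /=; case: (a (- 1%:Z)) => [|c].
  by rewrite muln0 expr0 mulr1 subrr !mul0r mulr0 invr1 subrr !(mul0r, mulr0).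
by rewrite mul2n -addnn !exprD /= !exprS; field; rewrite q0 !expf_neq0.
Qed.
(** * Representation of the operators in the quantum torus *)

Section Coordinates.
Variables (c : seq int) (w : X -> X).
Hypotheses (c_uniq : uniq c) (c_size : (size c < 7)%N)
  (c_away : forall k, k \in c -> inI n k /\ away w k) (lin_w : linear w).

Definition coord (a : int -> nat) (z : nat -> int) : int -> nat :=
  fun i => if i \in c then absz (z (index i c).+1) else a i.

(** Only the exponents listed in [c] vary with z; all others stay as in [a]. The operator [w] is
    treated as a further variable whose power is z_0, so only its commutation with the atoms
    matters. *)
Definition psi (a : int -> nat) (z : nat -> int) : X :=
  iter (absz (z 0%N)) w (mono (coord a z)).

Lemma coord_translate a z j m : (j < size c)%N ->
  coord a (translate (vec j.+1 m) z) = upd (coord a z) c`_j (absz (z j.+1 + m)).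
Proof.
move=> hj; apply: functional_extensionality => i; rewrite /coord /upd.
have [-> | ne] := eqVneq i c`_j.
  rewrite mem_nth // index_uniq // /translate nth_vec ?eqxx //.
  exact: leq_ltn_trans hj c_size.
case: ifP => // hi; rewrite /translate nth_vec; last exact: leq_ltn_trans hj c_size.
rewrite eqSS; case: eqP => [e|_]; last by rewrite addr0.
by rewrite -e nth_index ?eqxx in ne.
Qed.

Lemma coord_nth a z j : (j < size c)%N -> coord a z c`_j = absz (z j.+1).
Proof. by move=> hj; rewrite /coord mem_nth // index_uniq. Qed.

Lemma iter_comm (T : X -> X) m : opcomm w T -> opcomm T (iter m w).
Proof. by move=> h v; elim: m => //= m IH; rewrite -h IH. Qed.

Lemma translate0 j m z : translate (vec j.+1 m) z 0%N = z 0%N.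
Proof. by rewrite /translate /= addr0. Qed.

Lemma rep_atoms j : (j < size c)%N ->
  [/\ rep q psi (up c`_j) (tU j.+1), rep q psi (down c`_j) (tD j.+1),
      rep q psi (M c`_j) (tM j.+1) & rep q psi (Mi c`_j) (tMi j.+1)].
Proof.
move=> hj; have hj7 : (j.+1 < 7)%N by exact: leq_ltn_trans hj c_size.
have [hI [_ [cU cD cM cN]]] := c_away (mem_nth 0 hj).
have lw m : linear (iter m w) by apply: lin_iter.
split; [apply: rep_up|apply: rep_down|apply: rep_mu|apply: rep_muinv] => //.
- exact: lin_up.
- move=> a z hz; rewrite /psi iter_comm // up_mono // translate0 coord_translate // incrE.
  by rewrite coord_nth //; congr (iter _ _ (mono (upd _ _ _))); have := hz j.+1; lia.
- exact: lin_down.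
- move=> a z hz; rewrite /psi iter_comm // down_mono // translate0 coord_translate // decrE.
  rewrite coord_nth // (linZ _ _ (lw _)).
  have e : z j.+1 = (absz (z j.+1))%:Z by have := hz j.+1; lia.
  have -> : q ^ z j.+1 - q ^ (- z j.+1) = q ^+ absz (z j.+1) - q ^- absz (z j.+1).
    by rewrite e exprnN.
  (* At 0 the truncated predecessor is 0 while the absolute value of -1 is 1; the vanishing
     coefficient hides the mismatch. *)
  have [z0|z0] := posnP (absz (z j.+1)); first by rewrite z0 expr0 invr1 subrr !scale0r.
  by congr (_ *: iter _ _ (mono (upd _ _ _))); lia.
- move=> a z hz; rewrite /psi iter_comm // M_mono // (linZ _ _ (lw _)) coord_nth //.
  by rewrite -[q ^+ _]/(q ^ (absz _)%:Z); congr (q ^ _ *: _); have := hz j.+1; lia.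
- move=> a z hz; rewrite /psi iter_comm // Mi_mono // (linZ _ _ (lw _)) coord_nth //.
  by rewrite exprnN; congr (q ^ _ *: _); have := hz j.+1; lia.
Qed.

Lemma rep_w : rep q psi w (tU 0).
Proof.
apply: rep_up => // a z hz; rewrite /psi.
have -> : coord a (translate (vec 0 1) z) = coord a z.
  apply: functional_extensionality => i; rewrite /coord /translate.
  by case: ifP => // _; rewrite nth_vec // addr0.
rewrite /translate /= (_ : absz (z 0%N + 1) = (absz (z 0%N)).+1) //.
by have := hz 0%N; lia.
Qed.

(** Every normal monomial lies in the family with z_0 = 0, so identities checked on the family hold
    on all of X. *)
Lemma psi_mono a : psi a (fun j => if j is j'.+1 then (a c`_j')%:Z else 0) = mono a.
Proof.
rewrite /psi /=; congr mono; apply: functional_extensionality => i.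
by rewrite /coord; case: ifP => // hi; rewrite nth_index.
Qed.

Lemma rep_ext T S f g : rep q psi T f -> rep q psi S g -> tnull (f ++ topp g) -> T =1 S.
Proof.
move=> hT hS h; apply: mono_ext => [||a]; [by case: hT | by case: hS |].
rewrite -psi_mono; apply: (rep_eq _ hT hS h) => -[|j] //=.
Qed.

End Coordinates.

Definition tg (u v w z : int) : X -> X :=
  opD (M w \o Mi z \o up u \o down v) (opN (up w \o down z)).

Definition t1 (v w : int) : X -> X :=
  Mi w \o opD (up v) (opZ (q ^+ 2) (opD (up v \o M w \o M w)
    (opZ q (W 2 \o M v \o M w \o M w \o down w)))) \o down w.

Definition sgn (b : bool) (k : nat) : int := if b then - k%:Z else k%:Z.

(* For i > 1 both lam e_i and - lam f_i are given by the same expression, up to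
   exchanging the indices k and -k; likewise q [2]_q lam e_1 and q [2]_q lam f_1. *)
Definition step (b : bool) (i : nat) : X -> X :=
  if i == 1%N then t1 (sgn (~~ b) 1) (sgn b 1)
  else tg (sgn (~~ b) i) (sgn (~~ b) i.-1) (sgn b i.-1) (sgn b i).
Local Notation "f ** g" := (tmul f g) (at level 40, left associativity).

Section Generators.
Variable psi : (int -> nat) -> (nat -> int) -> X.

Definition atom (k : int) (p : nat) : Prop :=
  [/\ rep q psi (up k) (tU p), rep q psi (down k) (tD p),
      rep q psi (M k) (tM p) & rep q psi (Mi k) (tMi p)].

Definition ttg (u v w z : nat) : seq tterm :=
  (tM w ** tMi z ** tU u ** tD v) ++ topp (tU w ** tD z).

Lemma rep_tg u v w z pu pv pw pz : atom u pu -> atom v pv -> atom w pw -> atom z pz ->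
  rep q psi (tg u v w z) (ttg pu pv pw pz).
Proof.
move=> [Uu _ _ _] [_ Dv _ _] [Uw _ Mw _] [_ Dz _ Nz].
apply: rep_add; last exact/rep_opp/rep_comp.
by do 3!apply: rep_comp => //.
Qed.

Definition tt1 (fW : seq tterm) (v w : nat) : seq tterm :=
  tMi w ** (tU v ++ tconst [:: (1, 2)] ** ((tU v ** tM w ** tM w) ++
    tconst [:: (1, 1)] ** (fW ** tM v ** tM w ** tM w ** tD w))) ** tD w.

Lemma lval_q2 : q ^+ 2 = lval q [:: (1, 2)].
Proof. by rewrite /lval big_seq1 mul1r. Qed.

Lemma lval_q : q = lval q [:: (1, 1)].
Proof. by rewrite /lval big_seq1 mul1r. Qed.

Lemma rep_t1 fW v w pv pw : rep q psi (W 2) fW -> atom v pv -> atom w pw ->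
  rep q psi (t1 v w) (tt1 fW pv pw).
Proof.
move=> hW [Uv _ Mv _] [_ Dw Mw Nw].
apply: rep_comp => //; apply: rep_comp => //; apply: rep_add => //.
apply: (rep_scale q0 lval_q2); apply: rep_add; first by do 2!apply: rep_comp => //.
by apply: (rep_scale q0 lval_q); do 4!apply: rep_comp => //.
Qed.

Definition tW (fW : seq tterm) (u z : nat) : seq tterm :=
  (tU u ** tU z) ++ tconst [:: (1, 1)] ** (fW ** tM u ** tM z).

Lemma rep_W i fW u z : (1 <= i <= n)%N -> rep q psi (W i.+1) fW ->
  atom (- i%:Z) u -> atom i%:Z z -> rep q psi (W i) (tW fW u z).
Proof.
move=> hi hW [Uu _ Mu _] [Uz _ Mz _]; rewrite W_rec //; apply: rep_add; first exact: rep_comp.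
by apply: (rep_scale q0 lval_q); do 2!apply: rep_comp => //.
Qed.

Definition tk1 (v w : nat) := tM v ** tM v ** tMi w ** tMi w.
Definition tk1i (v w : nat) := tMi v ** tMi v ** tM w ** tM w.
Definition tk (u v w z : nat) := tM u ** tMi v ** tM w ** tMi z.
Definition tki (u v w z : nat) := tMi u ** tM v ** tMi w ** tM z.

Lemma rep_k1 v w : atom (- 1%:Z) v -> atom 1%:Z w ->
  rep q psi (k_op M Mi 1) (tk1 v w) /\ rep q psi (kinv_op M Mi 1) (tk1i v w).
Proof. by move=> [_ _ Mv Nv] [_ _ Mw Nw]; split; do 3!apply: rep_comp => //. Qed.

Lemma pred_index i : (1 < i)%N -> (i%:Z - 1 = i.-1%:Z) * (1 - i%:Z = - i.-1%:Z).
Proof. by move=> h; split; lia. Qed.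

Lemma rep_k i u v w z : (1 < i)%N -> atom (- i%:Z) u -> atom (- i.-1%:Z) v ->
  atom i.-1%:Z w -> atom i%:Z z ->
  rep q psi (k_op M Mi i) (tk u v w z) /\ rep q psi (kinv_op M Mi i) (tki u v w z).
Proof.
move=> h1 [_ _ Mu Nu] [_ _ Mv Nv] [_ _ Mw Nw] [_ _ Mz Nz].
rewrite /k_op /kinv_op; have /negPf -> : i != 1%N by lia.
by rewrite !pred_index //; split; do 3!apply: rep_comp => //.
Qed.

End Generators.

Lemma lin_t1_head v w : linear (Mi w \o opD (up v) (opZ (q ^+ 2)
  (opD (up v \o M w \o M w) (opZ q (W 2 \o M v \o M w \o M w \o down w))))).
Proof.
apply: lin_comp => //; apply: lin_opD; first exact: lin_up.
apply/lin_opZ/lin_opD; first exact: (lin_comp (lin_comp (@lin_up _) (Mlin _)) (Mlin _)).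
exact: (lin_opZ _ (lin_comp (lin_comp (lin_comp (lin_comp (@lin_W _) (Mlin _)) (Mlin _)) (Mlin
  _)) (lin_down _))).
Qed.

Lemma lin_step b i : linear (step b i).
Proof.
rewrite /step; case: ifP => _; first exact: (lin_comp (lin_t1_head _ _) (lin_down _)).
apply: lin_opD; first exact: (lin_comp (lin_comp (lin_comp (Mlin _) (Milin _)) (@lin_up _))
  (lin_down _)).
exact: (lin_opN (lin_comp (@lin_up _) (lin_down _))).
Qed.

(** * Relations decided by normal forms *)

Definition serre2 (a : F) (S T : X -> X) : X -> X :=
  opD (S \o S \o T) (opD (opN (opZ a (S \o T \o S))) (T \o S \o S)).

Definition serre3 (a : F) (S T : X -> X) : X -> X :=
  opD (opD (S \o S \o S \o T) (opZ a (S \o T \o S \o S)))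
    (opN (opD (opZ a (S \o S \o T \o S)) (T \o S \o S \o S))).

Definition tserre2 l f g := (f ** f ** g) ++ topp (tconst l ** (f ** g ** f)) ++ (g ** f ** f).
Definition tserre3 l f g :=
  ((f ** f ** f ** g) ++ (tconst l ** (f ** g ** f ** f))) ++
  topp ((tconst l ** (f ** f ** g ** f)) ++ (g ** f ** f ** f)).

Section Relations.
Variables (c : seq int) (w : X -> X).
Hypotheses (c_uniq : uniq c) (c_size : (size c < 7)%N)
  (c_away : forall k, k \in c -> inI n k /\ away w k) (lin_w : linear w).
Notation rep := (rep q (psi c w)).

Lemma atom_nth j k : (j < size c)%N -> c`_j = k -> atom (psi c w) k j.+1.
Proof. by move=> hj <-; apply: rep_atoms. Qed.

Lemma rep_null T f : rep T f -> tnull f -> T =1 @op0 F X.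
Proof.
move=> hT h v; rewrite (@rep_ext c w T (opZ 0 T) f (tmul (tconst [::]) f)) //.
- by rewrite /opZ scale0r.
- by apply: (rep_scale q0) => //; rewrite /lval big_nil.
by rewrite /tmul /= cats0.
Qed.

Lemma rep_opcomm S T f g : rep S f -> rep T g -> tnull (f ** g ++ topp (g ** f)) -> opcomm S T.
Proof. by move=> hS hT h; apply: (rep_ext (rep_comp q0 hS hT) (rep_comp q0 hT hS)). Qed.

Lemma rep_serre2 l S T f g : rep S f -> rep T g -> tnull (tserre2 l f g) ->
  serre2 (lval q l) S T =1 @op0 F X.
Proof.
move=> hS hT; apply: rep_null; apply: rep_add; first by do 2!apply: rep_comp => //.
apply: rep_add; last by do 2!apply: rep_comp => //.
by apply/rep_opp/rep_scale => //; do 2!apply: rep_comp => //.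
Qed.

Lemma rep_serre3 l S T f g : rep S f -> rep T g -> tnull (tserre3 l f g) ->
  serre3 (lval q l) S T =1 @op0 F X.
Proof.
move=> hS hT; apply: rep_null; apply: rep_add; last apply: rep_opp; apply: rep_add;
  try (apply: rep_scale => //); by do 3!apply: rep_comp => //.
Qed.

Lemma rep_conj l K Ki T fK fKi f : rep K fK -> rep Ki fKi -> rep T f ->
  tnull (fK ** f ** fKi ++ topp (tconst l ** f)) -> K \o T \o Ki =1 opZ (lval q l) T.
Proof.
move=> hK hKi hT h; apply: (rep_ext _ _ h); last exact: (rep_scale q0 erefl hT).
by do 2!apply: rep_comp => //.
Qed.

Lemma rep_bracket l S T K Ki f g fK fKi : rep S f -> rep T g -> rep K fK -> rep Ki fKi ->
  tnull (f ** g ++ topp (g ** f) ++ topp (tconst l ** (fK ++ topp fKi))) ->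
  opD (S \o T) (opN (T \o S)) =1 opZ (lval q l) (opD K (opN Ki)).
Proof.
move=> hS hT hK hKi; rewrite catA => h; apply: (@rep_ext c w _ _ _ _ _ _ h).
  by apply: rep_add; [|apply: rep_opp]; apply: rep_comp.
exact: (rep_scale q0 erefl (rep_add hK (rep_opp hKi))).
Qed.

End Relations.
(** Slots 1, 2, 3, 4 stand for -i, -(i-1), i-1, i and slots 5, 6 for -(i+1), i+1. In [tstep1] one
    has i = 2, and W_2 is expanded once over W_3 in slot 0; [tstep2] belongs to i and [tstep3] to i
    + 1. *)
Definition tstep1 (b : bool) : seq tterm :=
  if b then tt1 (tW (tU 0) 1 4) 3 2 else tt1 (tW (tU 0) 1 4) 2 3.
Definition tstep2 (b : bool) : seq tterm := if b then ttg 4 3 2 1 else ttg 1 2 3 4.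
Definition tstep3 (b : bool) : seq tterm := if b then ttg 6 4 1 5 else ttg 5 1 4 6.

Lemma step_gt1 b i : (1 < i)%N ->
  step b i = tg (sgn (~~ b) i) (sgn (~~ b) i.-1) (sgn b i.-1) (sgn b i).
Proof. by rewrite /step; case: i => [|[|i]]. Qed.

Definition eps (b : bool) (e : int) : int := if b then - e else e.

(** * Relations between equal or adjacent indices *)

Section Same.
Variable i : nat.
Hypothesis hi : (1 < i <= n)%N.
Let c := [:: - i%:Z; - i.-1%:Z; i.-1%:Z; i%:Z].
Notation P := (psi c (W i.+1)).

Lemma same_uniq : uniq c. Proof. by rewrite /= !inE; lia. Qed.

Lemma same_away k : k \in c -> inI n k /\ away (W i.+1) k.
Proof.
rewrite !inE => hk; have hI : inI n k by rewrite /inI; lia.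
by split=> //; apply: away_W => //; lia.
Qed.

Lemma same_atoms : [/\ atom P (- i%:Z) 1, atom P (- i.-1%:Z) 2, atom P i.-1%:Z 3 & atom P i%:Z 4].
Proof. by split; apply: atom_nth => //; first [exact: same_uniq | exact: same_away | exact:
  lin_W]. Qed.

Lemma same_rep b : rep q P (step b i) (tstep2 b).
Proof.
have [a1 a2 a3 a4] := same_atoms; rewrite step_gt1; last by case/andP: hi.
by case: b; apply: rep_tg.
Qed.

Lemma same_rep_k : rep q P (k_op M Mi i) (tk 1 2 3 4) /\ rep q P (kinv_op M Mi i) (tki 1 2 3 4).
Proof. by have [a1 a2 a3 a4] := same_atoms; apply: rep_k => //; case/andP: hi. Qed.

Lemma same_rep_W : rep q P (W i.-1) (tW (tW (tU 0) 1 4) 2 3) /\ rep q P (W i) (tW (tU 0) 1 4).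
Proof.
have [a1 a2 a3 a4] := same_atoms.
have h : rep q P (W i) (tW (tU 0) 1 4).
  by apply: rep_W => //; [lia | apply: rep_w => //;
    first [exact: lin_W | exact: same_uniq | exact: same_away]].
split=> //; apply: rep_W => //; first by lia.
by rewrite prednK //; lia.
Qed.

(** The scalar is -lambda: the steps are lam e_i and - lam f_i, and the bracket of e_i and f_i has
    denominator lambda. *)
Lemma same_bracket :
  opD (step false i \o step true i) (opN (step true i \o step false i)) =1
  opZ (lval q [:: (-1, 1); (1, -1)]) (opD (k_op M Mi i) (opN (kinv_op M Mi i))).
Proof.
have [hK hKi] := same_rep_k.
by apply: (rep_bracket (same_rep _) (same_rep _) hK hKi); vm_compute.
Qed.

Lemma same_conj b : k_op M Mi i \o step b i \o kinv_op M Mi i =1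
  opZ (lval q [:: (1, eps b 2)]) (step b i).
Proof.
by have [hK hKi] := same_rep_k; apply: (rep_conj hK hKi (same_rep _)); case: b; vm_compute.
Qed.

(** All four exponents touched by index i enter W_(i-1), so commutation is not formal; expanding
    W_(i-1) twice, down to W_(i+1), makes it computable. It starts the induction for distant
    indices. *)
Lemma same_W : [/\ (forall b, opcomm (step b i) (W i.-1)), opcomm (k_op M Mi i) (W i.-1)
  & k_op M Mi i \o kinv_op M Mi i =1 id /\ kinv_op M Mi i \o k_op M Mi i =1 id].
Proof.
have [hK hKi] := same_rep_k; have [hW _] := same_rep_W.
split.
- by move=> b; apply: (rep_opcomm (same_rep _) hW); case: b; vm_compute.
- by apply: (rep_opcomm hK hW); vm_compute.
by split; [apply: (rep_ext (rep_comp q0 hK hKi) (rep_id _ _))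
          |apply: (rep_ext (rep_comp q0 hKi hK) (rep_id _ _))]; vm_compute.
Qed.

End Same.

Section First.
Hypothesis n2 : (1 < n)%N.
Let hi : (1 < 2 <= n)%N := n2.
Notation P := (psi [:: - 2%:Z; - 1%:Z; 1%:Z; 2%:Z] (W 3)).

Lemma first_rep b : rep q P (step b 1) (tstep1 b).
Proof.
have [a1 a2 a3 a4] := same_atoms hi; have [_ hW] := same_rep_W hi.
by case: b; apply: rep_t1.
Qed.

Lemma first_rep_k :
  rep q P (k_op M Mi 1) (tk1 2 3) /\ rep q P (kinv_op M Mi 1) (tk1i 2 3).
Proof. by have [a1 a2 a3 a4] := same_atoms hi; apply: rep_k1. Qed.

(** The scalar is q^4 - 1 = (q [2]_q lam)^2 / (q^2 - q^-2), as [2]_q lam = q^2 - q^-2. *)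
Lemma first_bracket :
  opD (step false 1 \o step true 1) (opN (step true 1 \o step false 1)) =1
  opZ (lval q [:: (1, 4); (-1, 0)]) (opD (k_op M Mi 1) (opN (kinv_op M Mi 1))).
Proof.
have [hK hKi] := first_rep_k.
by apply: (rep_bracket (first_rep _) (first_rep _) hK hKi); vm_compute.
Qed.

Lemma first_conj b :
  [/\ k_op M Mi 1 \o step b 1 \o kinv_op M Mi 1 =1 opZ (lval q [:: (1, eps b 4)]) (step b 1),
      k_op M Mi 1 \o step b 2 \o kinv_op M Mi 1 =1 opZ (lval q [:: (1, eps b (-2))]) (step b 2)
    & k_op M Mi 2 \o step b 1 \o kinv_op M Mi 2 =1 opZ (lval q [:: (1, eps b (-2))]) (step b 1)].
Proof.
have [hK hKi] := first_rep_k; have [hK2 hKi2] := same_rep_k hi.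
split; [apply: (rep_conj hK hKi (first_rep _)) | apply: (rep_conj hK hKi (same_rep hi _))
       | apply: (rep_conj hK2 hKi2 (first_rep _))]; by case: b; vm_compute.
Qed.

Lemma first_kinv : k_op M Mi 1 \o kinv_op M Mi 1 =1 id /\ kinv_op M Mi 1 \o k_op M Mi 1 =1 id.
Proof.
have [hK hKi] := first_rep_k.
by split; [apply: (rep_ext (rep_comp q0 hK hKi) (rep_id _ _))
          |apply: (rep_ext (rep_comp q0 hKi hK) (rep_id _ _))]; vm_compute.
Qed.

Lemma first_comm b : opcomm (step b 1) (step (~~ b) 2).
Proof. by apply: (rep_opcomm (first_rep _) (same_rep hi _)); case: b; vm_compute. Qed.

Lemma first_serre b :
  serre2 (lval q [:: (1, 2); (1, -2)]) (step b 1) (step b 2) =1 @op0 F X /\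
  serre3 (lval q [:: (1, 2); (1, 0); (1, -2)]) (step b 2) (step b 1) =1 @op0 F X.
Proof.
by split; [apply: (rep_serre2 (first_rep _) (same_rep hi _))
          |apply: (rep_serre3 (same_rep hi _) (first_rep _))]; case: b; vm_compute.
Qed.

End First.

Section Adjacent.
Variable i : nat.
Hypothesis hi : (1 < i < n)%N.
Let c := [:: - i%:Z; - i.-1%:Z; i.-1%:Z; i%:Z; - i.+1%:Z; i.+1%:Z].
Notation P := (psi c id).

Lemma adj_uniq : uniq c. Proof. by rewrite /= !inE; lia. Qed.

Lemma adj_away k : k \in c -> inI n k /\ away id k.
Proof. by rewrite !inE => hk; split=> //; rewrite /inI; lia. Qed.

Lemma adj_atoms : [/\ atom P (- i%:Z) 1, atom P (- i.-1%:Z) 2, atom P i.-1%:Z 3 & atom P i%:Z 4]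
  /\ atom P (- i.+1%:Z) 5 /\ atom P i.+1%:Z 6.
Proof. by split; [split|split]; apply: atom_nth => //;
  first [exact: adj_uniq | exact: adj_away]. Qed.

Lemma adj_rep b : rep q P (step b i) (tstep2 b) /\ rep q P (step b i.+1) (tstep3 b).
Proof.
have [[a1 a2 a3 a4] [a5 a6]] := adj_atoms; rewrite !step_gt1; try lia.
by split; case: b; apply: rep_tg.
Qed.

Lemma adj_rep_k :
  (rep q P (k_op M Mi i) (tk 1 2 3 4) /\ rep q P (kinv_op M Mi i) (tki 1 2 3 4)) /\
  (rep q P (k_op M Mi i.+1) (tk 5 1 4 6) /\ rep q P (kinv_op M Mi i.+1) (tki 5 1 4 6)).
Proof.
by have [[a1 a2 a3 a4] [a5 a6]] := adj_atoms; split; apply: rep_k => //; lia.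
Qed.

Lemma adj_conj b :
  k_op M Mi i \o step b i.+1 \o kinv_op M Mi i =1 opZ (lval q [:: (1, eps b (-1))]) (step b i.+1)
  /\ k_op M Mi i.+1 \o step b i \o kinv_op M Mi i.+1 =1 opZ (lval q [:: (1, eps b (-1))]) (step
    b i).
Proof.
have [[hK hKi] [hK2 hKi2]] := adj_rep_k; have [h1 h2] := adj_rep b.
by split; [apply: (rep_conj hK hKi h2) | apply: (rep_conj hK2 hKi2 h1)]; case: (b); vm_compute.
Qed.

Lemma adj_comm b : opcomm (step b i) (step (~~ b) i.+1).
Proof.
have [h1 _] := adj_rep b; have [_ h2] := adj_rep (~~ b).
by apply: (rep_opcomm h1 h2); case: (b); vm_compute.
Qed.

Lemma adj_serre b :
  serre2 (lval q [:: (1, 1); (1, -1)]) (step b i) (step b i.+1) =1 @op0 F X /\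
  serre2 (lval q [:: (1, 1); (1, -1)]) (step b i.+1) (step b i) =1 @op0 F X.
Proof.
have [h1 h2] := adj_rep b.
by split; [apply: (rep_serre2 h1 h2) | apply: (rep_serre2 h2 h1)]; case: (b); vm_compute.
Qed.

End Adjacent.
(** * Distant indices *)

Lemma opcomm_step_gt1 g b i : (1 < i <= n)%N -> linear g ->
  (forall k, inI n k -> (absz k == i) || (absz k == i.-1) -> away g k) -> opcomm g (step b i).
Proof.
move=> hi lg h.
have [[_ [U1 D1 M1 N1]] [_ [U2 D2 M2 N2]]] : away g (sgn b i) /\ away g (sgn (~~ b) i).
  by split; apply: h; case: (b) => /=; rewrite /inI; lia.
have [[_ [U3 D3 M3 N3]] [_ [U4 D4 M4 N4]]] : away g (sgn b i.-1) /\ away g (sgn (~~ b) i.-1).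
  by split; apply: h; case: (b) => /=; rewrite /inI; lia.
rewrite step_gt1; last by case/andP: hi.
apply: opcomm_opD => //; last by apply: opcomm_opN => //; apply: opcomm_comp.
by do 3!apply: opcomm_comp => //.
Qed.

Lemma opcomm_step1 g b : (0 < n)%N -> linear g -> opcomm g (W 2) ->
  away g 1%:Z -> away g (- 1%:Z) -> opcomm g (step b 1).
Proof.
move=> n0 lg gW a1 a2.
have [_ [U1 D1 M1 N1]] : away g (sgn b 1) by case: (b).
have [_ [U2 D2 M2 N2]] : away g (sgn (~~ b) 1) by case: (b).
apply: opcomm_comp => //; apply: opcomm_comp => //; apply: opcomm_opD => //.
apply: opcomm_opZ => //; apply: opcomm_opD => //; first by do 2!apply: opcomm_comp => //.
by apply: opcomm_opZ => //; do 4!apply: opcomm_comp => //.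
Qed.

(** Below j the recursion only adds operators that commute with [g] by assumption, so commutation
    descends from W_j to W_l. *)
Lemma opcomm_W g j : linear g -> (1 <= j <= n.+1)%N -> opcomm g (W j) ->
  (forall k, inI n k -> (absz k < j)%N -> away g k) ->
  forall l, (1 <= l <= j)%N -> opcomm g (W l).
Proof.
move=> lg hj gW h l hl; have [d e] : exists d, (l + d = j)%N by exists (j - l)%N; lia.
elim: d l hl e => [|d IH] l hl e; first by rewrite (_ : l = j) //; lia.
have [_ [U1 _ M1 _]] : away g l%:Z by apply: h; rewrite /inI; lia.
have [_ [U2 _ M2 _]] : away g (- l%:Z) by apply: h; rewrite /inI; lia.
rewrite W_rec; last by lia.
apply: opcomm_opD => //; first exact: opcomm_comp.
apply: opcomm_opZ => //; do 2!apply: opcomm_comp => //.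
by apply: IH; lia.
Qed.

Lemma away_step b j k : (1 < j <= n)%N -> inI n k ->
  (absz k != j) -> (absz k != j.-1) -> away (step b j) k.
Proof.
move=> hj hk k1 k2.
have al l T : inI n l -> local T l -> (absz l == j) || (absz l == j.-1) -> away T k.
  by move=> hl hT h; apply: (away_local hk hT); lia.
have I1 b' : inI n (sgn b' j) by case: b' => /=; rewrite /inI; lia.
have I2 b' : inI n (sgn b' j.-1) by case: b' => /=; rewrite /inI; lia.
have e1 b' : (absz (sgn b' j) == j) || (absz (sgn b' j) == j.-1).
  by case: b' => /=; lia.
have e2 b' : (absz (sgn b' j.-1) == j) || (absz (sgn b' j.-1) == j.-1).
  by case: b' => /=; lia.
have aN T : away T k -> away (opN T) k.
  move=> /(away_opZ (-1)); suff -> : opN T = opZ (-1) T by [].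
  by apply: functional_extensionality => v; rewrite /opZ scaleN1r.
rewrite step_gt1; last by case/andP: hj.
apply: away_opD; [apply: away_comp; [apply: away_comp; [apply: away_comp|]|]|apply: aN;
  apply: away_comp];
  first [ exact: (al _ _ (I1 _) (local_up (I1 _)) (e1 _))
        | exact: (al _ _ (I2 _) (local_up (I2 _)) (e2 _))
        | exact: (al _ _ (I1 _) (local_down (I1 _)) (e1 _))
        | exact: (al _ _ (I2 _) (local_down (I2 _)) (e2 _))
        | exact: (al _ _ (I2 _) (local_M (I2 _)) (e2 _))
        | exact: (al _ _ (I1 _) (local_Mi (I1 _)) (e1 _)) ].
Qed.

Lemma away_k j k : (1 <= j <= n)%N -> inI n k ->
  (absz k != j) -> (absz k != j.-1) -> away (k_op M Mi j) k.
Proof.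
move=> hj hk k1 k2.
have al l T : (inI n l -> local T l) -> (absz l == j) || (absz l == j.-1) && (0 < absz l)%N ->
    away T k.
  move=> hT h; have hl : inI n l by rewrite /inI; lia.
  by apply: (away_local hk (hT hl)); lia.
rewrite /k_op; case: eqP => j1.
  by apply: away_comp; [apply: away_comp; [apply: away_comp|]|]; first [apply: al;
    [exact: local_M|] | apply: al; [exact: local_Mi|]];
    rewrite j1.
by apply: away_comp; [apply: away_comp; [apply: away_comp|]|]; first [apply: al;
  [exact: local_M|] | apply: al; [exact: local_Mi|]];
  lia.
Qed.

(** For i > 1 the two sets of exponents are disjoint. For i = 1 the operator W_2 overlaps with j;
    [same_W] handles W_(j-1), and from there commutation descends to W_2. *)
Lemma far_comm b b' i j : (1 <= i)%N -> (i.+1 < j <= n)%N -> opcomm (step b j) (step b' i).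
Proof.
move=> i0 hj; have [e|i1] := eqVneq i 1%N; last first.
  by apply: opcomm_step_gt1 => [||k hk h]; [lia | exact: lin_step | apply: away_step => //; lia].
rewrite {}e in hj *; have hj' : (1 < j <= n)%N by lia.
have [h _ _] := same_W hj'.
have ha k : inI n k -> (absz k < j.-1)%N -> away (step b j) k.
  by move=> hk hkj; apply: away_step => //; lia.
have n0 : (0 < n)%N by lia.
apply: opcomm_step1 => //; first exact: lin_step.
- by apply: (@opcomm_W _ j.-1) => //; [exact: lin_step | lia | lia].
- by apply: ha; [rewrite /inI | ]; lia.
- by apply: ha; [rewrite /inI | ]; lia.
Qed.

Lemma lin_k i : linear (k_op M Mi i) /\ linear (kinv_op M Mi i).
Proof. by rewrite /k_op /kinv_op; case: ifP => _; split; do 3!apply: lin_comp => //. Qed.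

Lemma far_k b i j : (1 <= i <= n)%N -> (1 <= j <= n)%N -> i != j -> i.+1 != j -> j.+1 != i ->
  opcomm (k_op M Mi i) (step b j).
Proof.
move=> hi hj h1 h2 h3; have [lk _] := lin_k i.
have [e|j1] := eqVneq j 1%N; last first.
  by apply: opcomm_step_gt1 => [||k hk h] //; [lia | apply: away_k => //; lia].
rewrite {}e in hj h1 h2 h3 *; have hi' : (1 < i <= n)%N by lia.
have [_ h _] := same_W hi'.
have ha k : inI n k -> (absz k < i.-1)%N -> away (k_op M Mi i) k.
  by move=> hk hki; apply: away_k => //; lia.
have n0 : (0 < n)%N by lia.
apply: opcomm_step1 => //; first by apply: (@opcomm_W _ i.-1) => //; lia.
  by apply: ha; [rewrite /inI | ]; lia.
by apply: ha; [rewrite /inI | ]; lia.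
Qed.

(** * Cartan operators, conjugation, and brackets of different indices *)

Definition diagonal (T : X -> X) : Prop :=
  linear T /\ exists c : (int -> nat) -> F, forall a, T (mono a) = c a *: mono a.

Lemma diagonal_comp S T : diagonal S -> diagonal T -> diagonal (S \o T).
Proof.
move=> [lS [c eS]] [lT [d eT]]; split; first exact: lin_comp.
by exists (fun a => d a * c a) => a; rewrite /= eT (linZ _ _ lS) eS scalerA.
Qed.

Lemma diagonal_comm S T : diagonal S -> diagonal T -> S \o T =1 T \o S.
Proof.
move=> [lS [c eS]] [lT [d eT]]; apply: mono_ext => [||a]; try exact: lin_comp.
by rewrite /= eT eS (linZ _ _ lS) (linZ _ _ lT) eS eT !scalerA mulrC.
Qed.

Lemma diagonal_k i : (1 <= i <= n)%N -> diagonal (k_op M Mi i).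
Proof.
move=> hi.
have dM l : inI n l -> diagonal (M l).
  by move=> hl; split=> //; exists (fun a => q ^+ a l) => a; rewrite M_mono.
have dN l : inI n l -> diagonal (Mi l).
  by move=> hl; split=> //; exists (fun a => q ^- a l) => a; rewrite Mi_mono.
rewrite /k_op; case: eqP => i1;
  (apply: diagonal_comp; [apply: diagonal_comp; [apply: diagonal_comp|]|]);
  solve [apply: dM; rewrite /inI; lia | apply: dN; rewrite /inI; lia].
Qed.

Lemma k_kinv i : (1 < n)%N -> (1 <= i <= n)%N ->
  k_op M Mi i \o kinv_op M Mi i =1 id /\ kinv_op M Mi i \o k_op M Mi i =1 id.
Proof.
move=> n2 hi; have [->|i1] := eqVneq i 1%N; first exact: first_kinv.
by have hi' : (1 < i <= n)%N by [lia]; have [_ _] := same_W hi'.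
Qed.

Lemma lval1 e : lval q [:: (1, e)] = q ^ e.
Proof. by rewrite /lval big_seq1 mul1r. Qed.

Lemma conj_step b i j : (1 < n)%N -> (1 <= i <= n)%N -> (1 <= j <= n)%N ->
  k_op M Mi i \o step b j \o kinv_op M Mi i =1 opZ (qi q i ^ eps b (cartan i j)) (step b j).
Proof.
move=> n2 hi hj.
(* For i = 1 the parameter is q_1 = q^2, while the torus computations give powers of q. *)
have q2 (e : int) : (q ^+ 2) ^ e = q ^ (2 * e) by rewrite -exprz_exp.
have [c11 c12 c21] := first_conj n2 b.
rewrite /cartan; case: (altP (i =P j)) => [<-{j hj}|ij].
  have [->|i1] := eqVneq i 1%N.
    by move=> v; rewrite c11 lval1 q2; congr (opZ (q ^ _) _ v); case: (b).
  have hi' : (1 < i <= n)%N by lia.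
  by move=> v; rewrite same_conj // lval1 /qi (negPf i1); case: (b).
case: ifP => [/andP[/eqP-> /eqP->]|h12].
  by move=> v; rewrite c12 lval1 q2; congr (opZ (q ^ _) _ v); case: (b).
case: ifP => [/andP[/eqP-> /eqP->]|h21].
  by move=> v; rewrite c21 lval1.
case: ifP => [/orP[/eqP e|/eqP e]|h].
- have hi' : (1 < i < n)%N by lia.
  have [h _] := adj_conj hi' b; rewrite -e => v; rewrite h lval1 /qi.
  by rewrite (_ : i == 1%N = false) //; lia.
- have hj' : (1 < j < n)%N by lia.
  have [_ h] := adj_conj hj' b; rewrite -e => v; rewrite h lval1 /qi.
  by rewrite (_ : j.+1 == 1%N = false) //; lia.
have [h1 _] := k_kinv n2 hi.
have far : opcomm (k_op M Mi i) (step b j) by apply: far_k => //; lia.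
by move=> v; rewrite /= far [k_op _ _ _ _]h1 /opZ /eps oppr0 if_same expr0z scale1r.
Qed.

Lemma comm_step b i j : (1 < n)%N -> (1 <= i <= n)%N -> (1 <= j <= n)%N -> i != j ->
  opcomm (step b i) (step (~~ b) j).
Proof.
move=> n2; wlog ij : b i j / (i < j)%N => [H|] hi hj ne.
  have [ij|ji] := ltnP i j; first exact: H.
  have ji' : (j < i)%N by lia.
  (* Exchanging the indices also exchanges the roles of E and F, hence the flipped sign. *)
  by have := H (~~ b) j i ji' hj hi; rewrite negbK eq_sym => /(_ ne); apply: opcomm_sym.
have [e|ne1] := eqVneq i.+1 j; last by apply: opcomm_sym; apply: far_comm; lia.
rewrite -{}e in hj *; have [e|i1] := eqVneq i 1%N; first by rewrite e; apply: first_comm.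
by apply: adj_comm; lia.
Qed.

(** * Serre relations *)

Section Scaling.
Variables (E : nat -> X -> X) (i j : nat) (a b : F) (S T : X -> X).
Hypotheses (Ei : E i = opZ a S) (Ej : E j = opZ b T) (lS : linear S) (lT : linear T).

Lemma iter_scaled m v : iter m (E i) v = a ^+ m *: iter m S v.
Proof.
elim: m => [|m IH]; first by rewrite scale1r.
by rewrite !iterS IH Ei /opZ (linZ _ _ lS) scalerA exprS.
Qed.

(** Every summand contains E_i exactly d times and E_j once, so the scalars form a common factor. *)
Lemma serre_sum_scaled d : serre_deg i j = d -> forall v, serre_sum q E i j v =
  (b * a ^+ d) *: \sum_(t < d.+1) ((-1) ^+ t * qbinom (qi q i) d t) *: iter t S (T (iter (d - t)
    S v)).
Proof.
move=> hd v; rewrite /serre_sum hd scaler_sumr; apply: eq_bigr => t _.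
rewrite !iter_scaled Ej /opZ (linZ _ _ lT) (linZ _ _ (lin_iter _ lS)) (linZ _ _ (lin_iter _ lS)).
have -> : a ^+ d = a ^+ (d - t) * a ^+ t by rewrite -exprD subnK // leq_ord.
by rewrite !scalerA; congr (_ *: _); ring.
Qed.

End Scaling.

Section SmallSerre.
Variables (v : F) (S T : X -> X).
Hypotheses (v0 : v != 0) (v2 : v ^+ 2 != 1) (v4 : v ^+ 4 != 1) (v6 : v ^+ 6 != 1).

Let v2' : v * v - 1 != 0. Proof. by rewrite -expr2 subr_eq0. Qed.

Let qint1 : qint v 1 = 1.
Proof. by rewrite /qint !expr1 mulfV // subr_eq0 -(inj_eq (mulfI v0)) mulfV // -expr2. Qed.

Let qint2 : qint v 2 = v + v^-1.
Proof. by rewrite /qint; field; rewrite v0 v2'. Qed.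

Let qint3 : qint v 3 = v ^+ 2 + 1 + v ^- 2.
Proof. by rewrite /qint; field; rewrite v0 v2'. Qed.

(** This and the next fact make the denominators of the q-binomials up to degree 3 invertible. *)
Let qint2_neq0 : v + v^-1 != 0.
Proof.
apply: contra v4 => /eqP h; rewrite -subr_eq0.
have -> : v ^+ 4 - 1 = (v ^+ 2 - 1) * (v * (v + v^-1)) by field.
by rewrite h !mulr0.
Qed.

Let qint3_neq0 : v ^+ 2 + 1 + v ^- 2 != 0.
Proof.
apply: contra v6 => /eqP h; rewrite -subr_eq0.
have -> : v ^+ 6 - 1 = (v ^+ 2 - 1) * (v ^+ 2 * (v ^+ 2 + 1 + v ^- 2)) by field.
by rewrite h !mulr0.
Qed.

Let qbinom0 m : qbinom v m 0 = 1.
Proof. by rewrite /qbinom !big_ord0 divr1. Qed.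

Let qbinom1 m : qbinom v m 1 = qint v m.
Proof. by rewrite /qbinom !big_ord_recr !big_ord0 /= !mul1r qint1 divr1 subn0. Qed.

Lemma serre_sum1 y :
  \sum_(t < 2) ((-1) ^+ t * qbinom v 1 t) *: iter t S (T (iter (1 - t) S y)) = T (S y) - S (T y).
Proof.
by rewrite !big_ord_recr big_ord0 /= qbinom0 qbinom1 qint1 expr0 expr1 !mulr1 add0r scale1r
  scaleN1r.
Qed.

Lemma serre_sum2 y :
  \sum_(t < 3) ((-1) ^+ t * qbinom v 2 t) *: iter t S (T (iter (2 - t) S y)) =
  serre2 (v + v^-1) S T y.
Proof.
have qb : qbinom v 2 2 = 1.
  rewrite /qbinom !big_ord_recr !big_ord0 /= !mul1r -[(2 - 1)%N]/1%N -[(2 - 0)%N]/2%N.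
  by rewrite [qint v 2 * _]mulrC mulfV // qint1 qint2 mul1r.
rewrite !big_ord_recr big_ord0 /= qbinom0 qbinom1 qb qint2 expr0 expr1 add0r.
rewrite !mul1r sqrrN expr1n /serre2 /opD /opN /opZ /=.
by rewrite mulN1r scaleNr !mul1r !scale1r [RHS]addrC [- _ + T _]addrC.
Qed.

(** In [serre3] the term S^3 T is positive, whereas in the sum it carries (-1)^3; hence the global
    sign. *)
Lemma serre_sum3 y :
  \sum_(t < 4) ((-1) ^+ t * qbinom v 3 t) *: iter t S (T (iter (3 - t) S y)) =
  - serre3 (v ^+ 2 + 1 + v ^- 2) S T y.
Proof.
have qb2 : qbinom v 3 2 = qint v 3.
  rewrite /qbinom !big_ord_recr !big_ord0 /= !mul1r -[(3 - 1)%N]/2%N -[(3 - 0)%N]/3%N.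
  by rewrite qint1 mul1r mulfK // qint2.
have qb3 : qbinom v 3 3 = 1.
  rewrite /qbinom !big_ord_recr !big_ord0 /= !mul1r.
  rewrite -[(3 - 1)%N]/2%N -[(3 - 0)%N]/3%N -[(3 - 2)%N]/1%N.
  by rewrite qint1 mulr1 mul1r [qint v 2 * _]mulrC mulfV // mulf_neq0 // ?qint2 ?qint3.
rewrite !big_ord_recr big_ord0 /= qbinom0 qbinom1 qb2 qb3 qint3 expr0 expr1 add0r.
have -> : (-1) ^+ 3 = -1 :> F by rewrite exprS sqrrN expr1n mulr1.
rewrite sqrrN expr1n.
rewrite /serre3 /opD /opN /opZ /=.
rewrite !mul1r !mulN1r scaleNr scaleN1r scale1r opprB opprD.
by rewrite [LHS]addrAC [LHS]addrC -!addrA; congr (_ + (_ + _)); apply: addrC.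
Qed.

End SmallSerre.

Hypothesis q_root : forall m : nat, (0 < m)%N -> q ^+ m != 1.

Lemma serre_scaled b i j (E : nat -> X -> X) (s : nat -> F) :
  (1 < n)%N -> (1 <= i <= n)%N -> (1 <= j <= n)%N -> i != j ->
  (forall k, (1 <= k <= n)%N -> E k = opZ (s k) (step b k)) ->
  serre_sum q E i j = @op0 F X.
Proof.
move=> n2 hi hj ij hE; apply: functional_extensionality => v.
have sum d : serre_deg i j = d -> _ := @serre_sum_scaled E i j _ _ _ _ (hE i hi) (hE j hj)
  (lin_step b i) (lin_step b j) d ^~ v.
have q2 m : (0 < m)%N -> (q ^+ 2) ^+ m != 1 by move=> m0; rewrite -exprM q_root // muln_gt0.
have q20 : q ^+ 2 != 0 by rewrite expf_neq0.
have l2 : q + q^-1 = lval q [:: (1, 1); (1, -1)].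
  by rewrite /lval !big_cons big_nil !mul1r addr0.
have l4 : q ^+ 2 + (q ^+ 2)^-1 = lval q [:: (1, 2); (1, -2)].
  by rewrite /lval !big_cons big_nil !mul1r addr0.
have l3 : q ^+ 2 + 1 + q ^- 2 = lval q [:: (1, 2); (1, 0); (1, -2)].
  by rewrite /lval !big_cons big_nil !mul1r addr0 addrA.
have [/andP[/eqP ei /eqP ej]|h12] := boolP ((i == 1) && (j == 2))%N.
  rewrite (sum 2%N) ei ej // /qi /= serre_sum2 ?q2 // l4.
  by rewrite (first_serre n2 b).1 /op0 scaler0.
have [/andP[/eqP ei /eqP ej]|h21] := boolP ((i == 2) && (j == 1))%N.
  rewrite (sum 3%N) ei ej // /qi /= serre_sum3 ?q_root // l3.
  by rewrite (first_serre n2 b).2 /op0 oppr0 scaler0.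
have [e|h1] := eqVneq i.+1 j.
  have hi' : (1 < i < n)%N by lia.
  rewrite (sum 2%N); last by rewrite /serre_deg /cartan (negPf ij) (negPf h12) (negPf h21) e eqxx.
  rewrite /qi (_ : i == 1%N = false); last by lia.
  by rewrite serre_sum2 ?q_root // l2 -e (adj_serre hi' b).1 /op0 scaler0.
have [e|h2] := eqVneq j.+1 i.
  have hj' : (1 < j < n)%N by lia.
  rewrite (sum 2%N); last first.
    by rewrite /serre_deg /cartan (negPf ij) (negPf h12) (negPf h21) e eqxx orbT.
  rewrite /qi (_ : i == 1%N = false); last by lia.
  by rewrite serre_sum2 ?q_root // l2 -e (adj_serre hj' b).2 /op0 scaler0.
(* Here a_ij = 0, so the Serre relation is plain commutation. *)
rewrite (sum 1%N); last first.
  by rewrite /serre_deg /cartan (negPf ij) (negPf h12) (negPf h21) (negPf h1) (negPf h2).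
have hc : opcomm (step b i) (step b j).
  have [ltij|leji] := ltnP i j; [apply: opcomm_sym |]; apply: far_comm; lia.
have [v0 v2] : qi q i != 0 /\ qi q i ^+ 2 != 1.
  by rewrite /qi; case: ifP => _; rewrite ?q2 ?q_root.
by rewrite serre_sum1 // hc subrr scaler0.
Qed.

Let lam0 : q - q^-1 != 0.
Proof. by rewrite subr_eq0 -(inj_eq (mulfI q0)) mulfV // -expr2 q_root. Qed.

(** * The generators in terms of [step] *)

Lemma D_down k : D k = opZ (q - q^-1)^-1 (down k).
Proof. by apply: functional_extensionality => v; rewrite /opZ /down /opZ scalerA mulVf //
  scale1r. Qed.

Lemma comp_opZ c (T S : X -> X) : linear T -> T \o opZ c S = opZ c (T \o S).
Proof. by move=> lT; apply: functional_extensionality => v; rewrite /opZ /= linZ. Qed.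

Lemma opZ_opZ c d (T : X -> X) : opZ c (opZ d T) = opZ (c * d) T.
Proof. by apply: functional_extensionality => v; rewrite /opZ scalerA. Qed.

Lemma opD_opZ c (S T : X -> X) : opD (opZ c S) (opN (opZ c T)) = opZ c (opD S (opN T)).
Proof. by apply: functional_extensionality => v; rewrite /opD /opN /opZ scalerBr. Qed.

Lemma up_pos i : (0 < i)%N -> up i.-1%:Z = tauPinv n Mi i \o xR x i.-1%:Z.
Proof. by case: i. Qed.

Definition scale_e (i : nat) : F :=
  if i == 1%N then (qint q 2)^-1 * q^-1 * (q - q^-1)^-1 else (q - q^-1)^-1.

Definition scale_f (i : nat) : F :=
  if i == 1%N then (qint q 2)^-1 * q^-1 * (q - q^-1)^-1 else - (q - q^-1)^-1.

(** The first summand of e_1 is up_(-1) by definition; the second is rewritten by [tauP_xR]. *)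
Lemma e_op1 : (0 < n)%N -> e_op q n x D M Mi 1 = opZ (scale_e 1) (step false 1).
Proof.
move=> n0; rewrite /e_op eqxx D_down.
have -> : tauPinv n Mi 2 \o xR x (-1) = _ := functional_extensionality _ _ (tauP_xR n0).
rewrite comp_opZ ?opZ_opZ //; exact: (@lin_t1_head (- 1%:Z) 1%:Z).
Qed.

Lemma f_op1 : (0 < n)%N -> f_op q n x D M Mi 1 = opZ (scale_f 1) (step true 1).
Proof.
move=> n0; rewrite /f_op eqxx D_down.
have -> : tauNinv n Mi 2 \o xL x 1 = _ := functional_extensionality _ _ (tauN_xL n0).
rewrite comp_opZ ?opZ_opZ //; exact: (@lin_t1_head 1%:Z (- 1%:Z)).
Qed.

Lemma e_op_gt1 i : (1 < i)%N -> e_op q n x D M Mi i = opZ (scale_e i) (step false i).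
Proof.
move=> hi; have i0 : (0 < i)%N by lia.
rewrite /e_op /scale_e (_ : i == 1%N = false); last by lia.
rewrite !pred_index // !D_down -up_pos // step_gt1 //.
rewrite -[_ \o xL x (- i%:Z)]/(M i.-1%:Z \o Mi i%:Z \o (tauNinv n Mi i.+1 \o xL x (- i%:Z))).
rewrite -up_neg // !(@comp_opZ (q - q^-1)^-1) ?opD_opZ //; first exact: lin_up.
exact: (lin_comp (lin_comp (Mlin _) (Milin _)) (@lin_up _)).
Qed.

Lemma f_op_gt1 i : (1 < i)%N -> f_op q n x D M Mi i = opZ (scale_f i) (step true i).
Proof.
move=> hi; have i0 : (0 < i)%N by lia.
rewrite /f_op /scale_f (_ : i == 1%N = false); last by lia.
rewrite !pred_index // !D_down step_gt1 //.
rewrite -[tauNinv n Mi i \o _]/(tauNinv n Mi i \o xL x (- i.-1%:Z)).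
rewrite -[_ \o xR x i%:Z]/(M (- i.-1%:Z) \o Mi (- i%:Z) \o up i%:Z).
have -> : tauNinv n Mi i \o xL x (- i.-1%:Z) = up (- i.-1%:Z).
  by rewrite up_neg ?prednK //; lia.
rewrite !(@comp_opZ (q - q^-1)^-1); [|exact: lin_up|exact: (lin_comp (lin_comp (Mlin _) (Milin
  _)) (@lin_up _))].
(* The two terms of f_i carry the opposite signs of those in [tg], which accounts for the minus in
   [scale_f]. *)
apply: functional_extensionality => v.
by rewrite /opD /opN /opZ /tg /= /opD /opN scaleNr scalerBr opprB addrC.
Qed.

Lemma uq_relations : (1 < n)%N ->
  Uq_relations q n (e_op q n x D M Mi) (f_op q n x D M Mi) (k_op M Mi) (kinv_op M Mi).
Proof.
move=> n2.
have eE k : (1 <= k <= n)%N -> e_op q n x D M Mi k = opZ (scale_e k) (step false k).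
  by move=> hk; have [->|k1] := eqVneq k 1%N; [apply: e_op1 | apply: e_op_gt1]; lia.
have eF k : (1 <= k <= n)%N -> f_op q n x D M Mi k = opZ (scale_f k) (step true k).
  by move=> hk; have [->|k1] := eqVneq k 1%N; [apply: f_op1 | apply: f_op_gt1]; lia.
have ext (S T : X -> X) : S =1 T -> S = T by exact: functional_extensionality.
have conj b i j a : (1 <= i <= n)%N -> (1 <= j <= n)%N ->
    k_op M Mi i \o opZ a (step b j) \o kinv_op M Mi i =
    opZ (qi q i ^ eps b (cartan i j)) (opZ a (step b j)).
  move=> hi hj; apply: ext => v; have [lk _] := lin_k i.
  rewrite /opZ /= (linZ _ _ lk) scalerA mulrC -scalerA; congr (_ *: _).
  by have := conj_step b n2 hi hj v.
move=> i j hi hj; split; first by apply/ext/diagonal_comm; apply: diagonal_k.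
split; first by have [h1 h2] := k_kinv n2 hi; split; apply: ext.
split; first by rewrite eE // conj.
split; first by rewrite eF // conj.
split; last by move=> ij; split; [apply: serre_scaled eE | apply: serre_scaled eF].
rewrite !eE // !eF //; set a := scale_e i; set b := scale_f j.
have -> : opD (opZ a (step false i) \o opZ b (step true j))
    (opN (opZ b (step true j) \o opZ a (step false i))) =
  opZ (a * b) (opD (step false i \o step true j) (opN (step true j \o step false i))).
  apply: ext => v; rewrite /opD /opN /opZ /= !(linZ _ _ (@lin_step _ _)) !scalerA scalerBr.
  by rewrite [b * a]mulrC.
have [eij|ij] := eqVneq i j; last first.
  apply: ext => v; have := comm_step false n2 hi hj ij v; rewrite /opZ /opD /opN /= => ->.
  by rewrite subrr scaler0.
rewrite /b -eij /a /scale_e /scale_f /qi; have [->|i1] := eqVneq i 1%N.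
  rewrite (ext _ _ (first_bracket n2)) opZ_opZ; congr (opZ _ _).
  have -> : lval q [:: (1, 4); (-1, 0)] = q ^+ 2 * (q ^+ 2 - (q ^+ 2)^-1).
    rewrite mulrBr mulfV ?expf_neq0 // -exprD /lval !big_cons big_nil.
    by rewrite expr0z mul1r mulr1 addr0.
  have : q ^+ 2 - (q ^+ 2)^-1 != 0.
    by rewrite subr_eq0 -(inj_eq (mulfI (expf_neq0 2 q0))) mulfV ?expf_neq0 // -exprD q_root.
  (* With l = q - q^-1, m = q^2 - q^-2 and [2]_q = m / l, both differences become independent
     nonzero symbols, and the claim is (q m)^-2 q^2 m = m^-1. *)
  rewrite /qint; move: (q ^+ 2 - _) (q - q^-1) lam0 => m l l0 m0.
  by field; rewrite q0 l0 m0.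
have hi' : (1 < i <= n)%N by lia.
rewrite (ext _ _ (same_bracket hi')) opZ_opZ; congr (opZ _ _).
have -> : lval q [:: (-1, 1); (1, -1)] = - (q - q^-1).
  by rewrite /lval !big_cons big_nil !mul1r mulN1r addr0 opprB addrC.
by rewrite -(mulrNN (_ * _)) opprK mulrN opprK -mulrA mulVf ?mulr1.
Qed.

End SymplecticSpace.

Theorem theorem3p6
  (F : fieldType) (Hchar : [pchar F] =i pred0)
  (q : F) (Hq0 : q != 0) (Hqroot : forall m : nat, (0 < m)%N -> q ^+ m != 1)
  (n : nat) (Hn : (2 <= n)%N)
  (X : algType F) (x : int -> X)
  (* defining relations of the quantum symplectic space *)
  (Hrel1 : forall i j : int, inI n i -> inI n j -> i < j -> j != - i ->
             x j * x i = q *: (x i * x j))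
  (Hrel2 : forall i : nat, (1 <= i <= n)%N ->
             x (i%:Z) * x (- (i%:Z)) =
               q ^+ 2 *: (x (- (i%:Z)) * x (i%:Z))
               + (q ^+ 2 * (q - q^-1)) *: Omega q n x i.+1)
  (* generation: x_i generate X as an algebra and normal monomials span X *)
  (Hspan : forall v : X, exists (m : nat) (a : 'I_m -> int -> nat) (c : 'I_m -> F),
             v = \sum_(k < m) c k *: mono n x (a k))
  (* normal monomials are linearly independent *)
  (Hindep : forall (m : nat) (a : 'I_m -> int -> nat) (c : 'I_m -> F),
             (forall k l : 'I_m, k != l -> exists i, inI n i /\ a k i <> a l i) ->
             \sum_(k < m) c k *: mono n x (a k) = 0 ->
             forall k, c k = 0)
  (* the operators partial_i, mu_i, mu_i^{-1}: linear maps given on the basis *)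
  (D M Mi : int -> X -> X)
  (HDlin : forall i, linear (D i)) (HMlin : forall i, linear (M i))
  (HMilin : forall i, linear (Mi i))
  (HD : forall i a, inI n i ->
          D i (mono n x a) = qint q (a i) *: mono n x (decr a i))
  (HM : forall i a, inI n i -> M i (mono n x a) = q ^+ a i *: mono n x a)
  (HMi : forall i a, inI n i -> Mi i (mono n x a) = q ^- a i *: mono n x a) :
  Uq_relations q n (e_op q n x D M Mi) (f_op q n x D M Mi)
    (k_op M Mi) (kinv_op M Mi).
Proof.
exact: (uq_relations Hq0 Hrel1 Hrel2 Hspan HDlin HMlin HMilin HD HM HMi Hqroot Hn).
Qed.
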